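(* Let $a\neq\tfrac14$, $d=\tfrac14$ and $b=e\neq0$. Then $\mathcal L=\mathcal L_{a,b,d,e}$ is a real Lie algebra of dimension $6$ with basis (where $\exp$ is the exponential function) \begin{align*} v_1&=b\exp(bt)x\,\partial_x+b\exp(bt)y\,\partial_y+\exp(bt)\partial_t+2b\exp(bt)\big(b(x+y)-(a+\tfrac14)\big)u\,\partial_u,\\ v_2&=-b\exp(-bt)x\,\partial_x-b\exp(-bt)y\,\partial_y+\exp(-bt)\partial_t,\qquad v_3=\partial_t-b(\tfrac14+a)u\,\partial_u,\\ v_4&=\sqrt y\exp(\tfrac b2t)\partial_y+2b\sqrt y\exp(\tfrac b2t)u\,\partial_u,\qquad v_5=\sqrt y\exp(-\tfrac b2t)\partial_y,\qquad v_6=u\,\partial_u, \end{align*} and $\mathcal L\cong\mathcal M\cong\mathcal H_{0,0}$.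
   Context: All Lie algebras are real. For real constants $a,b,d,e$ consider the PDE $$\Delta:=(a-bx)u_x+(d-ey)u_y+\tfrac x2u_{xx}+\tfrac y2u_{yy}+u_t=0$$ for $u=u(x,y,t)$, $x,y>0$, $t\in\mathbb R$. An infinitesimal symmetry of the PDE is a smooth vector field $v=\xi\partial_x+\gamma\partial_y+\tau\partial_t+\phi\partial_u$ on $\{(x,y,t,u):x>0,y>0,t\in\mathbb R,u\in\mathbb R\}$, with $\xi,\gamma,\tau,\phi$ functions of $(x,y,t,u)$, whose second prolongation $\mathrm{pr}^{(2)}v$ satisfies $\mathrm{pr}^{(2)}v(\Delta)=0$ at all points of the second jet space where $\Delta=0$. $\mathcal V_{a,b,d,e}$ is the Lie algebra of all infinitesimal symmetries, under the Lie bracket of vector fields. For every $v\in\mathcal V_{a,b,d,e}$ the coefficient $\phi$ is affine in $u$: $\phi=\lambda_v(x,y,t)u+\mu_v(x,y,t)$. Set $\mathcal L_{a,b,d,e}=\{v\in\mathcal V_{a,b,d,e}:\mu_v=0\}$. $\mathcal M$ is the 6-dimensional real Lie algebra with basis $E,F,H,X,Y,Z$ and nonzero brackets (up to antisymmetry) $[E,F]=H$, $[H,E]=2E$, $[H,F]=-2F$, $[X,Y]=Z$, $[E,Y]=X$, $[F,X]=Y$, $[H,X]=X$, $[H,Y]=-Y$; thus $\mathcal M\cong\mathfrak{sl}_2\ltimes\mathfrak h_3$ with $\mathfrak h_3=\langle X,Y,Z\rangle$ the Heisenberg algebra. $\mathcal H_{0,0}$ is the 6-dimensional Lie symmetry algebra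 of the heat equation $\frac{\partial u}{\partial t}=-\frac{\partial^2u}{\partial q^2}$ for $u=u(t,q)$ (the symmetries coming from linear superposition of solutions being left out).
   Formalization: The hypothesis a ≠ 3/4 is added: at a = 3/4 the field √x exp(−bt/2)∂_x − exp(−bt/2)/(2√x) u∂_u also lies in 𝓛 outside the span of v_1,…,v_6, so the claim fails there. *)

(* Defs.v *)
(* Stdlib real numbers and Coquelicot calculus; from MathComp only finite
   index types and iterated operators are used. *)
From Stdlib Require Import Reals.
From mathcomp Require Import ssreflect ssrfun ssrbool eqtype ssrnat seq choice.
From mathcomp Require Import fintype tuple bigop.
From Coquelicot Require Import Coquelicot.

Set Implicit Arguments.
Unset Strict Implicit.
Unset Printing Implicit Defensive.

Local Open Scope R_scope.

Notation "\rsum_ ( i < n ) F" := (\big[Rplus/0]_(i < n) F)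
  (at level 41, F at level 41, i, n at level 50,
   format "'[' \rsum_ ( i  <  n ) '/  '  F ']'") : R_scope.

(** * Calculus on coordinate spaces [K -> R], [K] a finite set of coordinates

    The uniform structure that Coquelicot puts on [K -> R] is the one of the
    sup norm. *)

Definition upd (K : eqType) (p : K -> R) (k : K) (s : R) : K -> R :=
  fun l => if l == k then s else p l.

Definition partial (K : eqType) (k : K) (f : (K -> R) -> R) (p : K -> R) : R :=
  Derive (fun s => f (upd p k s)) (p k).

Definition partials (K : eqType) (ks : seq K) (f : (K -> R) -> R) :
    (K -> R) -> R :=
  foldr (@partial K) f ks.

(* For an open set [D]: all iterated partial derivatives exist and are jointly
   continuous on [D]. Values of [f] outside [D] are irrelevant. *)
Definition smooth_on (K : eqType) (D : (K -> R) -> Prop) (f : (K -> R) -> R) :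
    Prop :=
  forall (ks : seq K) (p : K -> R), D p ->
    continuous (partials ks f) p /\
    forall k : K, ex_derive (fun s => partials ks f (upd p k s)) (p k).

(** * Vector fields in [n] independent variables and one dependent variable

    The coordinates of the total space are indexed by [option 'I_n]: [Some i]
    is the [i]-th independent variable, [None] is the dependent variable [u]. *)

Definition point (n : nat) := option 'I_n -> R.

(* [v (Some i)] is the coefficient of the i-th [d/dx_i], [v None] the one of
   [d/du]. *)
Definition vfield (n : nat) := option 'I_n -> point n -> R.

Definition sum_coord (n : nat) (F : option 'I_n -> R) : R :=
  \rsum_(i < n) F (Some i) + F None.

Definition vf_zero (n : nat) : vfield n := fun _ _ => 0.
Definition vf_add (n : nat) (v w : vfield n) : vfield n :=
  fun k p => v k p + w k p.
Definition vf_scale (n : nat) (c : R) (v : vfield n) : vfield n :=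
  fun k p => c * v k p.
Definition vf_bracket (n : nat) (v w : vfield n) : vfield n :=
  fun k p =>
    sum_coord (fun l => v l p * partial l (w k) p - w l p * partial l (v k) p).

(* Vector fields on the open set [D] are total functions considered up to
   their values outside [D]. *)
Definition vf_eq (n : nat) (D : point n -> Prop) (v w : vfield n) : Prop :=
  forall k p, D p -> v k p = w k p.

(** * Second jet space and second prolongation *)

(* [jp] is the point (x,u), [ju1 i] is u_i and [ju2 i j] is u_ij; only the
   elements with symmetric [ju2] are points of the jet space. *)
Record jet (n : nat) := Jet {
  jp : point n;
  ju1 : 'I_n -> R;
  ju2 : 'I_n -> 'I_n -> R
}.

Definition is_jet (n : nat) (j : jet n) : Prop :=
  forall i k, ju2 j i k = ju2 j k i.

Definition dj_p (n : nat) (k : option 'I_n) (F : jet n -> R) (j : jet n) : R :=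
  Derive (fun s => F (Jet (upd (jp j) k s) (ju1 j) (ju2 j))) (jp j k).

Definition dj_u1 (n : nat) (i : 'I_n) (F : jet n -> R) (j : jet n) : R :=
  Derive (fun s => F (Jet (jp j) (upd (ju1 j) i s) (ju2 j))) (ju1 j i).

(* u_ik and u_ki are one and the same jet coordinate, hence are varied
   together. *)
Definition dj_u2 (n : nat) (i k : 'I_n) (F : jet n -> R) (j : jet n) : R :=
  Derive (fun s => F (Jet (jp j) (ju1 j)
      (fun i' k' => if ((i' == i) && (k' == k)) || ((i' == k) && (k' == i))
                    then s else ju2 j i' k')))
    (ju2 j i k).

(* Total derivative with respect to the i-th independent variable of a function
   on the first jet space. *)
Definition tderiv (n : nat) (i : 'I_n) (F : jet n -> R) (j : jet n) : R :=
  dj_p (Some i) F j + ju1 j i * dj_p None F j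
  + \rsum_(k < n) (ju2 j i k * dj_u1 k F j).

Definition pullback (n : nat) (f : point n -> R) : jet n -> R := fun j => f (jp j).

(* Coefficient of d/du_i in the prolongation:
   phi^i = D_i phi - sum_k (D_i xi^k) u_k. *)
Definition pr_u1 (n : nat) (v : vfield n) (i : 'I_n) (j : jet n) : R :=
  tderiv i (pullback (v None)) j
  - \rsum_(k < n) (tderiv i (pullback (v (Some k))) j * ju1 j k).

(* Coefficient of d/du_il in the prolongation:
   phi^il = D_l phi^i - sum_k (D_l xi^k) u_ik. *)
Definition pr_u2 (n : nat) (v : vfield n) (i l : 'I_n) (j : jet n) : R :=
  tderiv l (pr_u1 v i) j
  - \rsum_(k < n) (tderiv l (pullback (v (Some k))) j * ju2 j i k).

Definition pr2 (n : nat) (v : vfield n) (F : jet n -> R) (j : jet n) : R :=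
  sum_coord (fun k => v k (jp j) * dj_p k F j)
  + \rsum_(i < n) (pr_u1 v i j * dj_u1 i F j)
  + \rsum_(i < n) \rsum_(l < n)
      (if (i <= l)%N then pr_u2 v i l j * dj_u2 i l F j else 0).

(** * Infinitesimal symmetries *)

Definition is_symmetry (n : nat) (D : point n -> Prop) (Delta : jet n -> R)
    (v : vfield n) : Prop :=
  (forall k, smooth_on D (v k)) /\
  (forall j : jet n, is_jet j -> D (jp j) -> Delta j = 0 -> pr2 v Delta j = 0).

(* phi = lambda u + mu, with lambda and mu functions of the independent
   variables. *)
Definition affine_in_u (n : nat) (D : point n -> Prop) (phi : point n -> R)
    (lambda mu : ('I_n -> R) -> R) : Prop :=
  forall p, D p ->
    phi p = lambda (fun i => p (Some i)) * p None + mu (fun i => p (Some i)).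

Definition is_linear_symmetry (n : nat) (D : point n -> Prop)
    (Delta : jet n -> R) (v : vfield n) : Prop :=
  is_symmetry D Delta v /\
  exists lambda, affine_in_u D (v None) lambda (fun _ => 0).

(** * Real Lie algebras

    A carrier given by a membership predicate [lmem] on a type, modulo the
    relation [lsame]. *)

Record lie_data := LieData {
  lcar :> Type;
  lmem : lcar -> Prop;
  lsame : lcar -> lcar -> Prop;
  lzero : lcar;
  ladd : lcar -> lcar -> lcar;
  lscale : R -> lcar -> lcar;
  lbr : lcar -> lcar -> lcar
}.

Record is_lie_algebra (G : lie_data) : Prop := IsLieAlgebra {
  lsame_refl : forall x : G, lmem x -> lsame x x;
  lsame_sym : forall x y : G, lmem x -> lmem y -> lsame x y -> lsame y x;
  lsame_trans : forall x y z : G, lmem x -> lmem y -> lmem z ->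
    lsame x y -> lsame y z -> lsame x z;
  lmem_zero : lmem (lzero G);
  lmem_add : forall x y : G, lmem x -> lmem y -> lmem (ladd x y);
  lmem_scale : forall c (x : G), lmem x -> lmem (lscale c x);
  lmem_br : forall x y : G, lmem x -> lmem y -> lmem (lbr x y);
  ladd_same : forall x x' y y' : G, lmem x -> lmem x' -> lmem y -> lmem y' ->
    lsame x x' -> lsame y y' -> lsame (ladd x y) (ladd x' y');
  lscale_same : forall c (x x' : G), lmem x -> lmem x' ->
    lsame x x' -> lsame (lscale c x) (lscale c x');
  lbr_same : forall x x' y y' : G, lmem x -> lmem x' -> lmem y -> lmem y' ->
    lsame x x' -> lsame y y' -> lsame (lbr x y) (lbr x' y');
  laddA : forall x y z : G, lmem x -> lmem y -> lmem z ->
    lsame (ladd x (ladd y z)) (ladd (ladd x y) z);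
  laddC : forall x y : G, lmem x -> lmem y -> lsame (ladd x y) (ladd y x);
  ladd0 : forall x : G, lmem x -> lsame (ladd x (lzero G)) x;
  laddN : forall x : G, lmem x -> lsame (ladd x (lscale (- 1) x)) (lzero G);
  lscale1 : forall x : G, lmem x -> lsame (lscale 1 x) x;
  lscaleA : forall c d (x : G), lmem x ->
    lsame (lscale c (lscale d x)) (lscale (c * d) x);
  lscaleDl : forall c d (x : G), lmem x ->
    lsame (lscale (c + d) x) (ladd (lscale c x) (lscale d x));
  lscaleDr : forall c (x y : G), lmem x -> lmem y ->
    lsame (lscale c (ladd x y)) (ladd (lscale c x) (lscale c y));
  lbrDl : forall x y z : G, lmem x -> lmem y -> lmem z ->
    lsame (lbr (ladd x y) z) (ladd (lbr x z) (lbr y z));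
  lbrDr : forall x y z : G, lmem x -> lmem y -> lmem z ->
    lsame (lbr x (ladd y z)) (ladd (lbr x y) (lbr x z));
  lbrZl : forall c (x y : G), lmem x -> lmem y ->
    lsame (lbr (lscale c x) y) (lscale c (lbr x y));
  lbrZr : forall c (x y : G), lmem x -> lmem y ->
    lsame (lbr x (lscale c y)) (lscale c (lbr x y));
  lbrxx : forall x : G, lmem x -> lsame (lbr x x) (lzero G);
  lbr_jacobi : forall x y z : G, lmem x -> lmem y -> lmem z ->
    lsame (ladd (lbr x (lbr y z)) (ladd (lbr y (lbr z x)) (lbr z (lbr x y))))
          (lzero G)
}.

Definition lincomb (G : lie_data) (m : nat) (c : 'I_m -> R) (vs : 'I_m -> G) :
    G :=
  \big[@ladd G/lzero G]_(i < m) lscale (c i) (vs i).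

Definition is_basis (G : lie_data) (m : nat) (vs : 'I_m -> G) : Prop :=
  [/\ forall i, lmem (vs i),
      forall c : 'I_m -> R,
        lsame (lincomb c vs) (lzero G) -> forall i, c i = 0
    & forall x : G, lmem x -> exists c : 'I_m -> R, lsame x (lincomb c vs)].

Definition lie_isomorphic (G H : lie_data) : Prop :=
  is_lie_algebra G /\ is_lie_algebra H /\
  exists f : G -> H,
    (forall x, lmem x -> lmem (f x)) /\
    (forall x y, lmem x -> lmem y -> (lsame x y <-> lsame (f x) (f y))) /\
    (forall x y, lmem x -> lmem y -> lsame (f (ladd x y)) (ladd (f x) (f y))) /\
    (forall c x, lmem x -> lsame (f (lscale c x)) (lscale c (f x))) /\
    (forall x y, lmem x -> lmem y -> lsame (f (lbr x y)) (lbr (f x) (f y))) /\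
    (forall y, lmem y -> exists x, lmem x /\ lsame (f x) y).

Definition linear_symmetries (n : nat) (D : point n -> Prop)
    (Delta : jet n -> R) : lie_data :=
  LieData (is_linear_symmetry D Delta) (vf_eq D)
    (@vf_zero n) (@vf_add n) (@vf_scale n) (@vf_bracket n).

(** * The equation in (x, y, t) *)

Definition iX : 'I_3 := @Ordinal 3 0 isT.
Definition iY : 'I_3 := @Ordinal 3 1 isT.
Definition iT : 'I_3 := @Ordinal 3 2 isT.

Definition quadrant (p : point 3) : Prop := 0 < p (Some iX) /\ 0 < p (Some iY).

Definition Delta_xyt (a b d e : R) (j : jet 3) : R :=
  let x := jp j (Some iX) in
  let y := jp j (Some iY) in
  (a - b * x) * ju1 j iX + (d - e * y) * ju1 j iY
  + x / 2 * ju2 j iX iX + y / 2 * ju2 j iY iY + ju1 j iT.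

Definition L (a b d e : R) : lie_data :=
  linear_symmetries quadrant (Delta_xyt a b d e).

(* xi d/dx + gamma d/dy + tau d/dt + phi d/du, the coefficients being functions
   of (x, y, t, u). *)
Definition vf3 (xi gamma tau phi : R -> R -> R -> R -> R) : vfield 3 :=
  fun k p =>
    (match k with
     | None => phi
     | Some i => if i == iX then xi else if i == iY then gamma else tau
     end) (p (Some iX)) (p (Some iY)) (p (Some iT)) (p None).

Definition v1 (a b : R) : vfield 3 := vf3
  (fun x y t u => b * exp (b * t) * x)
  (fun x y t u => b * exp (b * t) * y)
  (fun x y t u => exp (b * t))
  (fun x y t u => 2 * b * exp (b * t) * (b * (x + y) - (a + 1/4)) * u).

Definition v2 (b : R) : vfield 3 := vf3
  (fun x y t u => - b * exp (- b * t) * x)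
  (fun x y t u => - b * exp (- b * t) * y)
  (fun x y t u => exp (- b * t))
  (fun x y t u => 0).

Definition v3 (a b : R) : vfield 3 := vf3
  (fun x y t u => 0)
  (fun x y t u => 0)
  (fun x y t u => 1)
  (fun x y t u => - (b * (1/4 + a)) * u).

Definition v4 (b : R) : vfield 3 := vf3
  (fun x y t u => 0)
  (fun x y t u => sqrt y * exp (b / 2 * t))
  (fun x y t u => 0)
  (fun x y t u => 2 * b * sqrt y * exp (b / 2 * t) * u).

Definition v5 (b : R) : vfield 3 := vf3
  (fun x y t u => 0)
  (fun x y t u => sqrt y * exp (- b / 2 * t))
  (fun x y t u => 0)
  (fun x y t u => 0).

Definition v6 : vfield 3 := vf3
  (fun x y t u => 0)
  (fun x y t u => 0)
  (fun x y t u => 0)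
  (fun x y t u => u).

Definition vbasis (a b : R) : 'I_6 -> vfield 3 :=
  tnth [tuple v1 a b; v2 b; v3 a b; v4 b; v5 b; v6].

(** * The Lie algebra M *)

Inductive Mgen := gE | gF | gH | gX | gY | gZ.

Definition Mgen_eqb (i j : Mgen) : bool :=
  match i, j with
  | gE, gE | gF, gF | gH, gH | gX, gX | gY, gY | gZ, gZ => true
  | _, _ => false
  end.

Definition Mgen_sum (F : Mgen -> R) : R :=
  F gE + F gF + F gH + F gX + F gY + F gZ.

(* An element of M is given by its coordinates in the basis. *)
Definition Mgen_vec (i : Mgen) : Mgen -> R :=
  fun k => if Mgen_eqb i k then 1 else 0.

(* Brackets of basis elements, each pair being listed in one order only. *)
Definition M_table (i j : Mgen) : Mgen -> R :=
  match i, j with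
  | gE, gF => Mgen_vec gH
  | gH, gE => fun k => 2 * Mgen_vec gE k
  | gH, gF => fun k => - 2 * Mgen_vec gF k
  | gX, gY => Mgen_vec gZ
  | gE, gY => Mgen_vec gX
  | gF, gX => Mgen_vec gY
  | gH, gX => Mgen_vec gX
  | gH, gY => fun k => - Mgen_vec gY k
  | _, _ => fun _ => 0
  end.

Definition M_bracket (v w : Mgen -> R) : Mgen -> R :=
  fun k => Mgen_sum (fun i => Mgen_sum (fun j =>
    v i * w j * (M_table i j k - M_table j i k))).

Definition M : lie_data :=
  @LieData (Mgen -> R) (fun _ => True) (fun v w => forall k, v k = w k)
    (fun _ => 0) (fun v w k => v k + w k) (fun c v k => c * v k) M_bracket.

(** * The heat equation u_t = - u_qq in (t, q) *)

Definition hT : 'I_2 := @Ordinal 2 0 isT.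
Definition hQ : 'I_2 := @Ordinal 2 1 isT.

Definition Delta_heat (j : jet 2) : R := ju1 j hT + ju2 j hQ hQ.

(* The superposition symmetries f(t,q) d/du, f a solution, are left out by
   keeping only the fields with mu = 0. *)
Definition H00 : lie_data := linear_symmetries (fun _ => True) Delta_heat.

(* Main.v *)
(** A symmetry in [L] is [xi d/dx + gam d/dy + tau d/dt + phi d/du] with [phi]
    linear in [u]. Varying the mixed coordinates [u_xt], [u_yt], [u_xy] in the
    invariance condition shows that [tau] depends on [t] only and that [xi],
    [gam] do not depend on [u]; the coefficients of [u_xx], [u_yy], [u_xy] then
    force, for functions [T], [A], [B], [C] of [t],
    [tau = T], [xi = T' x + sqrt x (A - 2 C sqrt y)] and
    [gam = T' y + sqrt y (B + 2 C sqrt x)].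
    The coefficients of [u_x] and [u_y] give [phi_x] and [phi_y]; their
    integrability forces [C' = 0]. In the remaining zeroth-order equation the
    coefficient of [x^(-3/2)] is [(a-1/4)(a-3/4)/2 (A - 2 C sqrt y)], whence
    [A = C = 0], and what is left are the equations [T''' = b^2 T'] and
    [B'' = (b/2)^2 B], whose solutions give the combinations of [v1, ..., v6].
    The heat equation is treated in the same way. Once the symmetries are
    parametrized linearly and bijectively by the elements of [M], compatibly with
    the brackets of explicit fields, the Lie algebra axioms (closure under the
    bracket included) are transported from [M]. *)

Require Import Defs.
From Stdlib Require Import Reals Lra FunctionalExtensionality ClassicalEpsilon.
From HB Require Import structures.
From mathcomp Require Import ssreflect ssrfun ssrbool eqtype ssrnat seq choice.
From mathcomp Require Import fintype tuple bigop.
From Coquelicot Require Import Coquelicot.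

Set Implicit Arguments.
Unset Strict Implicit.
Unset Printing Implicit Defensive.

Local Open Scope R_scope.

(** The two excluded values of [a] have one origin. In [r = sqrt x] the part [a u_x + (x/2) u_xx]
    reads [(1/8) (u_rr + ((4a-1)/r) u_r)], and removing the first-order term by rescaling [u] with a
    power of [r] leaves the potential [- (a-1/4)(a-3/4) / (2 r^2)]. Without this potential the
    equation would be as homogeneous in [sqrt x] as it is in [sqrt y] for [d = 1/4]. The functions
    [A] and [C] stand for translations in [sqrt x] and rotations in the plane of [sqrt x] and
    [sqrt y], which an inverse-square potential forbids; [B], the translations in [sqrt y],
    survives. The drifts [- b x] and [- b y] amount to an oscillator term, whence exponentials in
    [t] where the heat equation has polynomials. *)

Lemma RplusA : associative Rplus. Proof. by move=> x y z; rewrite Rplus_assoc. Qed.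
Lemma RplusC : commutative Rplus. Proof. exact: Rplus_comm. Qed.
Lemma Rplus0x : left_id 0 Rplus. Proof. exact: Rplus_0_l. Qed.
HB.instance Definition _ := Monoid.isComLaw.Build R 0 Rplus RplusA RplusC Rplus0x.

(** * Smooth functions of several coordinates *)

Lemma is_derive_eq (f : R -> R) (x l l' : R) :
  is_derive f x l -> l = l' -> is_derive f x l'.
Proof. by move=> df <-. Qed.

Lemma is_derive_extR (f g : R -> R) (x l : R) : (forall s, f s = g s) ->
  is_derive f x l -> is_derive g x l.
Proof. exact: is_derive_ext. Qed.
Arguments is_derive_extR f [g x l] _ _.

Section Coordinates.
Variable K : eqType.
Implicit Types (p : K -> R) (D : (K -> R) -> Prop) (f g : (K -> R) -> R).

Lemma upd_same p k : upd p k (p k) = p.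
Proof. by apply: functional_extensionality => l; rewrite /upd; case: eqP => [->|]. Qed.

Lemma upd_upd p k r s : upd (upd p k r) k s = upd p k s.
Proof. by apply: functional_extensionality => l; rewrite /upd; case: eqP. Qed.

Lemma upd_eq p k s : upd p k s k = s.
Proof. by rewrite /upd eqxx. Qed.

Lemma open_upd D p k : open D -> D p -> locally (p k) (fun s => D (upd p k s)).
Proof.
move=> oD Dp; have [eps He] := oD p Dp.
exists eps => s Hs; apply: He => l; rewrite /upd.
case: eqP => [->|_] //; exact: ball_center.
Qed.

Lemma partial_ext D f g k p : open D -> (forall q, D q -> f q = g q) -> D p ->
  partial k f p = partial k g p.
Proof.
move=> oD fg Dp; apply: Derive_ext_loc.
by apply: filter_imp (open_upd k oD Dp) => s; apply: fg.
Qed.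

Lemma partials_ext D f g ks p : open D -> (forall q, D q -> f q = g q) -> D p ->
  partials ks f p = partials ks g p.
Proof.
move=> oD fg; elim: ks p => [|k ks IH] p Dp /=; first exact: fg.
exact: (partial_ext k oD IH Dp).
Qed.

Lemma smooth_on_ext D f g : open D -> (forall q, D q -> f q = g q) ->
  smooth_on D f -> smooth_on D g.
Proof.
move=> oD fg sf ks p Dp; have [cf df] := sf ks p Dp.
have E q : D q -> partials ks f q = partials ks g q by apply: partials_ext fg.
split.
  apply: continuous_ext_loc cf; apply: filter_imp (oD p Dp) => q; exact: E.
move=> k; apply: ex_derive_ext_loc (df k).
apply: filter_imp (open_upd k oD Dp) => s; exact: E.
Qed.

Lemma smooth_on_partial D f k : smooth_on D f -> smooth_on D (partial k f).
Proof.
move=> sf ks; have -> : partials ks (partial k f) = partials (rcons ks k) f.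
  by rewrite /partials foldr_rcons.
exact: sf.
Qed.

Lemma is_derive_partial D f k p : smooth_on D f -> D p ->
  is_derive (fun s => f (upd p k s)) (p k) (partial k f p).
Proof. by move=> sf Dp; apply: Derive_correct; have [_] := sf [::] p Dp; apply. Qed.

Lemma is_derive_partial_upd D f k p s : smooth_on D f -> D (upd p k s) ->
  is_derive (fun r => f (upd p k r)) s (partial k f (upd p k s)).
Proof.
move=> sf Dp; have := is_derive_partial k sf Dp; rewrite upd_eq.
by apply: is_derive_ext => r; rewrite upd_upd.
Qed.

(** The domain is a union of full lines in direction [l], so a vanishing [l]-derivative makes [f]
    constant along each of them. In the quadrant this applies to the coordinate [u]. *)
Lemma upd_indep D f l p s : smooth_on D f -> (forall q r, D q -> D (upd q l r)) ->
  (forall q, D q -> partial l f q = 0) -> D p -> f (upd p l s) = f p.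
Proof.
move=> sf fullD f0 Dp; rewrite -{2}(upd_same p l).
have df r : is_derive (fun r => f (upd p l r)) r 0.
  have Dr : D (upd p l r) by exact: fullD.
  by have := is_derive_partial_upd sf Dr; rewrite f0.
case: (Rtotal_order s (p l)) => [|[->//|]] lt; [|symmetry];
  exact: (@eq_is_derive R_NormedModule (fun r => f (upd p l r)) _ _
            (fun t _ => df t) lt).
Qed.

(* Avoids any appeal to the symmetry of mixed second derivatives. *)
Lemma partial_indep D f k l p : open D -> smooth_on D f ->
  (forall q r, D q -> D (upd q l r)) ->
  (forall q, D q -> partial l f q = 0) -> D p -> partial l (partial k f) p = 0.
Proof.
move=> oD sf fullD f0 Dp; have [<-|ne] := eqVneq l k.
  rewrite (partial_ext l oD f0 Dp); exact: Derive_const.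
apply: is_derive_unique; apply: (is_derive_ext (fun=> partial k f p)) => [s|].
  rewrite /partial; have -> : upd p l s k = p k.
    by rewrite /upd eq_sym (negbTE ne).
  apply: Derive_ext_loc.
  apply: filter_imp (open_upd k oD Dp) => r Dr.
  rewrite -(upd_indep s sf fullD f0 Dr); congr f.
  apply: functional_extensionality => m; rewrite /upd.
  by case: (m =P l) => [->|//]; rewrite (negbTE ne).
exact: is_derive_const.
Qed.

(** * Elementary functions are smooth *)

(** On [D] the class is closed under partial derivatives ([elementary_derive]), which reduces
    [smooth_on], a statement about all iterated partials, to continuity and a single
    differentiation. Inverses enter through the derivatives of square roots. *)
Inductive elementary D : ((K -> R) -> R) -> Prop :=
| elementary_const c : elementary D (fun=> c)
| elementary_coord k : elementary D (fun p => p k)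
| elementary_add f g : elementary D f -> elementary D g ->
    elementary D (fun p => f p + g p)
| elementary_mul f g : elementary D f -> elementary D g ->
    elementary D (fun p => f p * g p)
| elementary_exp f : elementary D f -> elementary D (fun p => exp (f p))
| elementary_inv f : elementary D f -> (forall p, D p -> f p <> 0) ->
    elementary D (fun p => / f p)
| elementary_sqrt f : elementary D f -> (forall p, D p -> 0 < f p) ->
    elementary D (fun p => sqrt (f p)).

Lemma elementary_opp D f : elementary D f -> elementary D (fun p => - f p).
Proof.
move=> ef; have -> : (fun p => - f p) = (fun p => (-1) * f p).
  by apply: functional_extensionality => p; ring.
by apply: elementary_mul => //; apply: elementary_const.
Qed.

Lemma elementary_sub D f g : elementary D f -> elementary D g ->
  elementary D (fun p => f p - g p).
Proof. by move=> ef eg; apply: elementary_add => //; apply: elementary_opp. Qed.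

Lemma elementary_div D f c : elementary D f -> elementary D (fun p => f p / c).
Proof. by move=> ef; apply: elementary_mul => //; apply: elementary_const. Qed.

Lemma elementary_pow D f m : elementary D f -> elementary D (fun p => f p ^ m).
Proof.
move=> ef; elim: m => [|m IH]; first exact: elementary_const.
exact: elementary_mul.
Qed.

Lemma elementary_continuous D f p : elementary D f -> D p -> continuous f p.
Proof.
move=> ef Dp; elim: ef => {f}.
- move=> c; exact: continuous_const.
- move=> k P [eps He]; exists eps => q Hq; apply: He; exact: Hq.
- move=> f g _ cf _ cg; exact: (continuous_plus f g).
- move=> f g _ cf _ cg; exact: (continuous_mult f g).
- move=> f _ cf; apply: (continuous_comp f exp) => //.
  by apply: ex_derive_continuous; exists (exp (f p)); apply: is_derive_exp.
- move=> f _ cf nz; apply: (continuous_comp f Rinv) => //.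
  exact: continuous_Rinv (nz p Dp).
- move=> f _ cf pos; apply: (continuous_comp f sqrt) => //.
  exact: continuous_sqrt.
Qed.

Lemma elementary_derive D f k : elementary D f -> exists2 g, elementary D g &
  forall p, D p -> is_derive (fun s => f (upd p k s)) (p k) (g p).
Proof.
elim=> {f}.
- move=> c; exists (fun=> 0); first exact: elementary_const.
  by move=> p _; apply: is_derive_const.
- move=> l; exists (fun=> if l == k then 1 else 0); first exact: elementary_const.
  move=> p _; rewrite /upd; case: eqP => _; first exact: is_derive_id.
  exact: is_derive_const.
- move=> f g _ [f' ef' df] _ [g' eg' dg].
  exists (fun p => f' p + g' p); first exact: elementary_add.
  by move=> p Dp; apply: is_derive_plus; [apply: df|apply: dg].
- move=> f g ef [f' ef' df] eg [g' eg' dg].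
  exists (fun p => f' p * g p + f p * g' p).
    by apply: elementary_add; apply: elementary_mul.
  move=> p Dp; have := is_derive_mult _ _ _ _ _ (df p Dp) (dg p Dp) Rmult_comm.
  by rewrite upd_same.
- move=> f ef [f' ef' df]; exists (fun p => f' p * exp (f p)).
    by apply: elementary_mul => //; apply: elementary_exp.
  move=> p Dp; have := is_derive_comp exp _ _ _ _ (is_derive_exp _) (df p Dp).
  by rewrite upd_same.
- move=> f ef [f' ef' df] nz.
  exists (fun p => ((-1) * f' p) * (/ f p * / f p)).
    have ei := elementary_inv ef nz.
    apply: elementary_mul; last exact: elementary_mul.
    by apply: elementary_mul => //; apply: elementary_const.
  move=> p Dp; have nzp := nz p Dp.
  have := is_derive_inv _ _ _ (df p Dp); rewrite upd_same => /(_ nzp) d.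
  by apply: is_derive_eq d _; field.
- move=> f ef [f' ef' df] pos.
  exists (fun p => (f' p * (/ 2)) * (sqrt (f p) * / f p)).
    apply: elementary_mul.
      by apply: elementary_mul => //; apply: elementary_const.
    apply: elementary_mul; first exact: elementary_sqrt.
    by apply: elementary_inv => // p /pos; lra.
  move=> p Dp; have posp := pos p Dp.
  have := is_derive_sqrt _ _ _ (df p Dp).
  rewrite upd_same => /(_ posp) d; apply: is_derive_eq d _.
  have s0 := sqrt_lt_R0 _ posp; have ss := sqrt_sqrt _ (Rlt_le _ _ posp).
  by rewrite -{3}ss; field; lra.
Qed.

Lemma elementary_smooth D f : open D -> elementary D f -> smooth_on D f.
Proof.
move=> oD ef ks.
have [g eg E] : exists2 g, elementary D g & forall p, D p -> partials ks f p = g p.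
  elim: ks => [|k ks [g eg E]] /=; first by exists f.
  have [g' eg' dg] := elementary_derive k eg.
  exists g' => // p Dp; rewrite (partial_ext k oD E Dp).
  exact/is_derive_unique/dg.
move=> p Dp; split.
  apply: continuous_ext_loc (elementary_continuous eg Dp).
  by apply: filter_imp (oD p Dp) => q /E.
move=> k; have [g' _ dg] := elementary_derive k eg.
apply: (ex_derive_ext_loc (fun s => g (upd p k s))); last by exists (g' p); apply: dg.
by apply: filter_imp (open_upd k oD Dp) => s /E.
Qed.

End Coordinates.

Ltac elementary_tac := repeat first
  [ exact: elementary_const | exact: elementary_coord | apply: elementary_div
  | apply: elementary_add | apply: elementary_sub | apply: elementary_pow
  | apply: elementary_mul | apply: elementary_opp | apply: elementary_exp
  | apply: elementary_sqrt ].

Lemma is_derive_rsum n (f : 'I_n -> R -> R) (f' : 'I_n -> R) x :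
  (forall i, is_derive (f i) x (f' i)) ->
  is_derive (fun s => \rsum_(i < n) f i s) x (\rsum_(i < n) f' i).
Proof.
elim: n f f' => [|n IH] f f' df.
  rewrite big_ord0; apply: (is_derive_ext (fun=> 0)); last exact: is_derive_const.
  by move=> s; rewrite big_ord0.
rewrite big_ord_recl.
apply: (is_derive_ext (fun s => f ord0 s + \rsum_(i < n) f (lift ord0 i) s)).
  by move=> s; rewrite big_ord_recl.
by apply: is_derive_plus; [|apply: IH].
Qed.

Lemma rsum_if n (i : 'I_n) (F : 'I_n -> R) :
  \rsum_(k < n) (if k == i then F k else 0) = F i.
Proof. by rewrite -big_mkcond /= big_pred1_eq. Qed.

(** * Prolongation *)

Section Prolongation.
Variable n : nat.
Implicit Types (D : point n -> Prop) (f : point n -> R) (v w : vfield n) (j : jet n).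

Definition tderiv1 f (i : 'I_n) j :=
  partial (Some i) f (jp j) + ju1 j i * partial (@None 'I_n) f (jp j).

(* The part of the second total derivative of [f] that does not involve the
   second-order jet coordinates. *)
Definition tderiv2 f (i l : 'I_n) j :=
  partial (Some l) (partial (Some i) f) (jp j)
  + ju1 j i * partial (Some l) (partial (@None 'I_n) f) (jp j)
  + ju1 j l * (partial (@None 'I_n) (partial (Some i) f) (jp j)
               + ju1 j i * partial (@None 'I_n) (partial (@None 'I_n) f) (jp j)).

Lemma tderiv_pullback f i j : tderiv i (pullback f) j = tderiv1 f i j.
Proof.
rewrite /tderiv big1 ?Rplus_0_r // => k _.
by rewrite /dj_u1 /pullback /= Derive_const Rmult_0_r.
Qed.

Lemma pr_u1E v i j :
  pr_u1 v i j = tderiv1 (v None) i j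
                - \rsum_(k < n) (tderiv1 (v (Some k)) i j * ju1 j k).
Proof.
rewrite /pr_u1 tderiv_pullback; congr (_ - _).
by apply: eq_bigr => k _; rewrite tderiv_pullback.
Qed.

Lemma is_derive_tderiv1 D f k i j : smooth_on D f -> D (jp j) ->
  is_derive (fun s => tderiv1 f i (Jet (upd (jp j) k s) (ju1 j) (ju2 j)))
    (jp j k)
    (partial k (partial (Some i) f) (jp j)
     + ju1 j i * partial k (partial (@None 'I_n) f) (jp j)).
Proof.
move=> sf Dp; rewrite /tderiv1 /=.
apply: is_derive_plus; first exact: is_derive_partial (smooth_on_partial _ sf) Dp.
by apply: is_derive_scal; apply: is_derive_partial (smooth_on_partial _ sf) Dp.
Qed.

Lemma dj_p_pr_u1 D v k i j : (forall l, smooth_on D (v l)) -> D (jp j) ->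
  dj_p k (pr_u1 v i) j =
  partial k (partial (Some i) (v None)) (jp j)
  + ju1 j i * partial k (partial (@None 'I_n) (v None)) (jp j)
  - \rsum_(m < n) ((partial k (partial (Some i) (v (Some m))) (jp j)
     + ju1 j i * partial k (partial (@None 'I_n) (v (Some m))) (jp j)) * ju1 j m).
Proof.
move=> sv Dp; apply: is_derive_unique.
apply: (is_derive_ext
  (fun s => tderiv1 (v None) i (Jet (upd (jp j) k s) (ju1 j) (ju2 j))
   - \rsum_(m < n) (tderiv1 (v (Some m)) i (Jet (upd (jp j) k s) (ju1 j) (ju2 j))
       * ju1 j m))) => [s|]; first by rewrite pr_u1E.
apply: is_derive_minus; first exact: is_derive_tderiv1 (sv _) Dp.
apply: is_derive_rsum => m.
apply: (is_derive_ext (fun s => ju1 j m *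
   tderiv1 (v (Some m)) i (Jet (upd (jp j) k s) (ju1 j) (ju2 j)))) => [s|].
  by rewrite Rmult_comm.
rewrite Rmult_comm; apply: is_derive_scal; exact: is_derive_tderiv1 (sv _) Dp.
Qed.

(** [pr_u1 v i] is quadratic in the first-order coordinates: [u_m] occurs inside the total
    derivatives if [m = i], and as the explicit factor of the [m]-th summand. The two terms on the
    right are these contributions. *)
Lemma dj_u1_pr_u1 v m i j :
  dj_u1 m (pr_u1 v i) j =
  (if m == i then partial (@None 'I_n) (v None) (jp j)
     - \rsum_(k < n) (partial (@None 'I_n) (v (Some k)) (jp j) * ju1 j k) else 0)
  - tderiv1 (v (Some m)) i j.
Proof.
apply: is_derive_unique.
apply: (is_derive_ext
  (fun s => (partial (Some i) (v None) (jp j)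
             + upd (ju1 j) m s i * partial (@None 'I_n) (v None) (jp j))
   - \rsum_(k < n) ((partial (Some i) (v (Some k)) (jp j)
       + upd (ju1 j) m s i * partial (@None 'I_n) (v (Some k)) (jp j))
       * upd (ju1 j) m s k))) => [s|]; first by rewrite pr_u1E.
(* [dl k] is the derivative of [u_k] with respect to [u_m]. *)
pose dl (k : 'I_n) := if k == m then 1 else 0.
have dU k : is_derive (fun s => upd (ju1 j) m s k) (ju1 j m) (dl k).
  rewrite /dl /upd; case: eqP => _; [exact: is_derive_id|exact: is_derive_const].
have dA A B : is_derive (fun s => A + upd (ju1 j) m s i * B) (ju1 j m) (dl i * B).
  apply: (is_derive_ext (fun s => A + B * upd (ju1 j) m s i)) => [s|].
    by rewrite (Rmult_comm B).
  have -> : dl i * B = 0 + B * dl i by ring.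
  by apply: is_derive_plus; [apply: is_derive_const|apply: is_derive_scal].
have -> : (if m == i then partial (@None 'I_n) (v None) (jp j)
     - \rsum_(k < n) (partial (@None 'I_n) (v (Some k)) (jp j) * ju1 j k) else 0)
  - tderiv1 (v (Some m)) i j
  = dl i * partial (@None 'I_n) (v None) (jp j) - \rsum_(k < n)
     (dl i * partial (@None 'I_n) (v (Some k)) (jp j) * ju1 j k
      + (if k == m then tderiv1 (v (Some k)) i j else 0)).
  rewrite big_split /= rsum_if /dl eq_sym; case: eqP => _.
    rewrite [X in _ = _ - (X + _)](eq_bigr
      (fun k => partial (@None 'I_n) (v (Some k)) (jp j) * ju1 j k)); first by rewrite /=; ring.
    by move=> k _ /=; ring.
  rewrite [X in _ = _ - (X + _)]big1 /=; first by ring.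
  by move=> k _ /=; ring.
apply: is_derive_minus; first exact: dA.
apply: is_derive_rsum => k.
have := is_derive_mult _ _ _ _ _ (dA (partial (Some i) (v (Some k)) (jp j))
  (partial (@None 'I_n) (v (Some k)) (jp j))) (dU k) Rmult_comm.
rewrite !upd_same /plus /mult /= /dl -/(tderiv1 _ i j).
case: (k == m); by rewrite ?Rmult_1_r ?Rmult_0_r.
Qed.

(** Eliminates derivatives on jet space in favour of partial derivatives of the coefficients. The
    result is affine in the second-order coordinates and polynomial in the first-order ones, so that
    invariance conditions can be split into coefficients. *)
Lemma pr_u2E D v i l j : (forall k, smooth_on D (v k)) -> D (jp j) ->
  pr_u2 v i l j =
  tderiv2 (v None) i l j - \rsum_(k < n) (tderiv2 (v (Some k)) i l j * ju1 j k)
  + ju2 j l i * (partial (@None 'I_n) (v None) (jp j)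
      - \rsum_(k < n) (partial (@None 'I_n) (v (Some k)) (jp j) * ju1 j k))
  - \rsum_(k < n) (ju2 j l k * tderiv1 (v (Some k)) i j)
  - \rsum_(k < n) (tderiv1 (v (Some k)) l j * ju2 j i k).
Proof.
move=> sv Dp; rewrite /pr_u2; congr (_ - _); last first.
  by apply: eq_bigr => k _; rewrite tderiv_pullback.
rewrite /tderiv !(dj_p_pr_u1 _ _ sv Dp).
have -> : \rsum_(k < n) (ju2 j l k * dj_u1 k (pr_u1 v i) j) =
  ju2 j l i * (partial (@None 'I_n) (v None) (jp j)
      - \rsum_(k < n) (partial (@None 'I_n) (v (Some k)) (jp j) * ju1 j k))
  - \rsum_(k < n) (ju2 j l k * tderiv1 (v (Some k)) i j).
  set W := partial (@None 'I_n) (v None) (jp j) - _.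
  rewrite -(rsum_if i (fun k => ju2 j l k * W)) /Rminus.
  have oppE (F : 'I_n -> R) : (- (\rsum_(k < n) F k)) = (\rsum_(k < n) (- F k)) :> R.
    by apply: (big_morph Ropp Ropp_plus_distr Ropp_0).
  rewrite oppE -big_split /=; apply: eq_bigr => k _.
  rewrite dj_u1_pr_u1 -/W /=; case: (k == i); ring.
have -> : \rsum_(k < n) (tderiv2 (v (Some k)) i l j * ju1 j k) =
 \rsum_(m < n) ((partial (Some l) (partial (Some i) (v (Some m))) (jp j)
     + ju1 j i * partial (Some l) (partial (@None 'I_n) (v (Some m))) (jp j)) * ju1 j m)
 + ju1 j l * \rsum_(m < n) ((partial (@None 'I_n) (partial (Some i) (v (Some m))) (jp j)
     + ju1 j i * partial (@None 'I_n) (partial (@None 'I_n) (v (Some m))) (jp j)) * ju1 j m).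
  rewrite (big_morph (Rmult (ju1 j l)) (Rmult_plus_distr_l _) (Rmult_0_r _)).
  rewrite -big_split /=; apply: eq_bigr => k _ /=; rewrite /tderiv2; ring.
by rewrite /tderiv2; ring.
Qed.

End Prolongation.

(** * Transport of structure from [M] *)

(** With the structure constants summed out, the axioms for the bracket of [M] become polynomial
    identities in coordinates. *)
Lemma M_bracketE (v w : Mgen -> R) k : M_bracket v w k =
  match k with
  | gE => 2 * (v gH * w gE - v gE * w gH)
  | gF => - 2 * (v gH * w gF - v gF * w gH)
  | gH => v gE * w gF - v gF * w gE
  | gX => v gE * w gY - v gY * w gE + (v gH * w gX - v gX * w gH)
  | gY => v gF * w gX - v gX * w gF - (v gH * w gY - v gY * w gH)
  | gZ => v gX * w gY - v gY * w gX
  end.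
Proof. by case: k; rewrite /M_bracket /Mgen_sum /= /Mgen_vec /=; ring. Qed.

Lemma M_is_lie_algebra : is_lie_algebra M.
Proof.
split=> //=.
- by move=> x y z _ _ _ xy yz k; rewrite xy.
- by move=> x x' y y' _ _ _ _ xx yy k; rewrite xx yy.
- by move=> c x x' _ _ xx k; rewrite xx.
- by move=> x x' y y' _ _ _ _ xx yy k; rewrite !M_bracketE !xx !yy.
- by move=> *; ring.
- by move=> *; ring.
- by move=> *; ring.
- by move=> *; ring.
- by move=> *; ring.
- by move=> *; ring.
- by move=> *; ring.
- by move=> *; ring.
- by move=> x y z _ _ _ k; rewrite !M_bracketE; case: k; ring.
- by move=> x y z _ _ _ k; rewrite !M_bracketE; case: k; ring.
- by move=> c x y _ _ k; rewrite !M_bracketE; case: k; ring.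
- by move=> c x y _ _ k; rewrite !M_bracketE; case: k; ring.
- by move=> x _ k; rewrite !M_bracketE; case: k; ring.
- by move=> x y z _ _ _ k; rewrite !M_bracketE; case: k; rewrite ?M_bracketE; ring.
Qed.

Section LinearSymmetries.
Variables (n : nat) (D : point n -> Prop) (Delta : jet n -> R).
Hypothesis oD : open D.
Implicit Types v w : vfield n.

Lemma vf_bracket_ext v v' w w' : vf_eq D v v' -> vf_eq D w w' ->
  vf_eq D (vf_bracket v w) (vf_bracket v' w').
Proof.
move=> vv ww k p Dp; rewrite /vf_bracket /sum_coord.
have E l : v l p * partial l (w k) p - w l p * partial l (v k) p =
           v' l p * partial l (w' k) p - w' l p * partial l (v' k) p.
  rewrite vv // ww // (partial_ext l oD (ww k) Dp).
  by rewrite (partial_ext l oD (vv k) Dp).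
by rewrite E; congr (_ + _); apply: eq_bigr.
Qed.

(** On an open set the prolongation sees only the values of the field there and their partial
    derivatives up to order two. Hence being a symmetry is a property of the class modulo [vf_eq];
    smoothness gives access to [pr_u2E] for both fields. *)
Lemma pr2_ext v w F j : (forall k, smooth_on D (v k)) ->
  (forall k, smooth_on D (w k)) -> vf_eq D v w -> D (jp j) ->
  pr2 v F j = pr2 w F j.
Proof.
move=> sv sw vw Dp.
have E1 k l : partial l (v k) (jp j) = partial l (w k) (jp j).
  exact: partial_ext oD (vw k) Dp.
have E2 k l m : partial m (partial l (v k)) (jp j)
                = partial m (partial l (w k)) (jp j).
  apply: partial_ext oD _ Dp => q Dq; exact: partial_ext oD (vw k) Dq.
have T1 k i : tderiv1 (v k) i j = tderiv1 (w k) i j by rewrite /tderiv1 !E1.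
have T2 k i l : tderiv2 (v k) i l j = tderiv2 (w k) i l j.
  by rewrite /tderiv2 !E2.
rewrite /pr2 /sum_coord (vw _ _ Dp); congr (_ + _ + _ + _).
- by apply: eq_bigr => i _; rewrite vw.
- apply: eq_bigr => i _; rewrite !pr_u1E T1; congr ((_ - _) * _).
  by apply: eq_bigr => k _; rewrite T1.
- apply: eq_bigr => i _; apply: eq_bigr => l _; case: ifP => // _.
  rewrite (pr_u2E _ _ sv Dp) (pr_u2E _ _ sw Dp) T2 E1; congr (_ * _).
  congr (_ - _ + _ * (_ - _) - _ - _); apply: eq_bigr => k _;
    by rewrite ?T2 ?T1 ?E1.
Qed.

Lemma is_linear_symmetry_ext v w : vf_eq D v w ->
  is_linear_symmetry D Delta v -> is_linear_symmetry D Delta w.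
Proof.
move=> vw [[sv pv] [lam hl]].
have sw k : smooth_on D (w k) by apply: smooth_on_ext oD _ (sv k) => q; apply: vw.
split; last by exists lam => p Dp; rewrite -vw ?hl.
split=> // j jj Dp D0; rewrite -(@pr2_ext v) //; exact: pv.
Qed.

Variable F : (Mgen -> R) -> vfield n.
Hypothesis F_mem : forall c, is_linear_symmetry D Delta (F c).
Hypothesis F_onto : forall v, is_linear_symmetry D Delta v ->
  exists c, vf_eq D v (F c).
Hypothesis F_add : forall c c',
  vf_eq D (F (fun k => c k + c' k)) (vf_add (F c) (F c')).
Hypothesis F_scale : forall r c,
  vf_eq D (F (fun k => r * c k)) (vf_scale r (F c)).
Hypothesis F_inj : forall c, vf_eq D (F c) (@vf_zero n) -> forall k, c k = 0.
Hypothesis F_bracket : forall c c',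
  vf_eq D (F (M_bracket c c')) (vf_bracket (F c) (F c')).

Let G := linear_symmetries D Delta.
(** [c] is the coordinate vector of [v]; every symmetry has one by [F_onto], and it is unique by
    [F_inj]. *)
Let repr v c := vf_eq D (F c) v.

Let repr_mem v c : repr v c -> is_linear_symmetry D Delta v.
Proof. by move=> vc; apply: is_linear_symmetry_ext vc _. Qed.

Let mem_repr v : is_linear_symmetry D Delta v -> exists c, repr v c.
Proof. by move=> /F_onto[c vc]; exists c => k p Dp; rewrite vc. Qed.

Let repr_zero : repr (@vf_zero n) (fun=> 0).
Proof.
have := F_scale 0 (fun=> 0); have -> : (fun k : Mgen => 0 * 0) = (fun=> 0).
  by apply: functional_extensionality => k; ring.
by move=> H k p Dp; rewrite H // /vf_scale /vf_zero; ring.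
Qed.

Let repr_add v w c c' : repr v c -> repr w c' ->
  repr (vf_add v w) (fun k => c k + c' k).
Proof. by move=> vc wc k p Dp; rewrite F_add // /vf_add vc // wc. Qed.

Let repr_scale r v c : repr v c -> repr (vf_scale r v) (fun k => r * c k).
Proof. by move=> vc k p Dp; rewrite F_scale // /vf_scale vc. Qed.

Let repr_bracket v w c c' : repr v c -> repr w c' ->
  repr (vf_bracket v w) (M_bracket c c').
Proof.
by move=> vc wc k p Dp; rewrite F_bracket //; apply: vf_bracket_ext vc wc _ _ Dp.
Qed.

Let repr_same v w c c' : repr v c -> repr w c' -> (forall k, c k = c' k) ->
  vf_eq D v w.
Proof.
move=> vc wc /functional_extensionality E k p Dp.
by rewrite -vc // E wc.
Qed.

Let repr_inj v c c' : repr v c -> repr v c' -> forall k, c k = c' k.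
Proof.
move=> vc vc' k.
have Z : vf_eq D (F (fun k => c k + (-1) * c' k)) (@vf_zero n).
  move=> l p Dp; rewrite F_add // /vf_add F_scale // /vf_scale vc // vc' //.
  by rewrite /vf_zero; ring.
by have := F_inj Z k; lra.
Qed.

(** The vector space identities hold pointwise. Closure and the bracket identities are read off
    coordinates: a field with a coordinate vector is a symmetry ([repr_mem]), and [F_bracket] turns
    brackets of symmetries, nested ones included, into brackets in [M]. *)
Let G_is_lie_algebra : is_lie_algebra G.
Proof.
have ML := M_is_lie_algebra.
split; rewrite /G /=.
- by [].
- by move=> x y _ _ xy k p Dp; rewrite xy.
- by move=> x y z _ _ _ xy yz k p Dp; rewrite xy // yz.
- exact: repr_mem repr_zero.
- move=> x y /mem_repr[c xc] /mem_repr[c' yc].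
  exact: repr_mem (repr_add xc yc).
- move=> r x /mem_repr[c xc]; exact: repr_mem (repr_scale r xc).
- move=> x y /mem_repr[c xc] /mem_repr[c' yc].
  exact: repr_mem (repr_bracket xc yc).
- by move=> x x' y y' _ _ _ _ xx yy k p Dp; rewrite /vf_add xx // yy.
- by move=> c x x' _ _ xx k p Dp; rewrite /vf_scale xx.
- by move=> x x' y y' _ _ _ _; apply: vf_bracket_ext.
- by move=> x y z _ _ _ k p _; rewrite /vf_add; ring.
- by move=> x y _ _ k p _; rewrite /vf_add; ring.
- by move=> x _ k p _; rewrite /vf_add /vf_zero; ring.
- by move=> x _ k p _; rewrite /vf_add /vf_scale /vf_zero; ring.
- by move=> x _ k p _; rewrite /vf_scale; ring.
- by move=> c d x _ k p _; rewrite /vf_scale; ring.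
- by move=> c d x _ k p _; rewrite /vf_add /vf_scale; ring.
- by move=> c x y _ _ k p _; rewrite /vf_add /vf_scale; ring.
- move=> x y z /mem_repr[c xc] /mem_repr[c' yc] /mem_repr[c'' zc].
  apply: repr_same (repr_bracket (repr_add xc yc) zc)
    (repr_add (repr_bracket xc zc) (repr_bracket yc zc)) _.
  exact: (lbrDl ML).
- move=> x y z /mem_repr[c xc] /mem_repr[c' yc] /mem_repr[c'' zc].
  apply: repr_same (repr_bracket xc (repr_add yc zc))
    (repr_add (repr_bracket xc yc) (repr_bracket xc zc)) _.
  exact: (lbrDr ML).
- move=> r x y /mem_repr[c xc] /mem_repr[c' yc].
  apply: repr_same (repr_bracket (repr_scale r xc) yc)
    (repr_scale r (repr_bracket xc yc)) _.
  exact: (lbrZl ML).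
- move=> r x y /mem_repr[c xc] /mem_repr[c' yc].
  apply: repr_same (repr_bracket xc (repr_scale r yc))
    (repr_scale r (repr_bracket xc yc)) _.
  exact: (lbrZr ML).
- move=> x /mem_repr[c xc].
  apply: repr_same (repr_bracket xc xc) repr_zero _; exact: (lbrxx ML).
- move=> x y z /mem_repr[c xc] /mem_repr[c' yc] /mem_repr[c'' zc].
  apply: repr_same (repr_add (repr_bracket xc (repr_bracket yc zc))
    (repr_add (repr_bracket yc (repr_bracket zc xc))
              (repr_bracket zc (repr_bracket xc yc)))) repr_zero _.
  exact: (lbr_jacobi ML).
Qed.

Lemma lie_isomorphic_M_symmetries : lie_isomorphic M G.
Proof.
split; first exact: M_is_lie_algebra.
split; first exact: G_is_lie_algebra.
exists F; split; first by move=> *; apply: F_mem.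
split.
  move=> c c' _ _; split=> [/functional_extensionality -> //|E].
  exact: (@repr_inj (F c')).
split; first by move=> *; apply: F_add.
split; first by move=> *; apply: F_scale.
split; first by move=> *; apply: F_bracket.
by move=> v /mem_repr[c vc]; exists c.
Qed.

(** The inverse direction needs a map on all vector fields: it picks a coordinate vector by
    [epsilon], with an arbitrary value off the symmetries. Uniqueness of coordinates ([repr_inj])
    makes the choice linear, compatible with brackets and independent of the representative modulo
    [vf_eq]. *)
Lemma lie_isomorphic_symmetries_M : lie_isomorphic G M.
Proof.
split; first exact: G_is_lie_algebra.
split; first exact: M_is_lie_algebra.
pose f v := epsilon (inhabits (fun=> 0)) (repr v).
have fP v : is_linear_symmetry D Delta v -> repr v (f v).
  by move=> /mem_repr E; apply: epsilon_spec.
exists f; split=> //; split.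
  move=> v w mv mw; split=> [vw|E]; last by apply: repr_same E; apply: fP.
  by apply: (@repr_inj w); [move=> k p Dp; rewrite -vw // fP|apply: fP].
split.
  move=> v w mv mw; have r := repr_add (fP _ mv) (fP _ mw).
  exact: repr_inj (fP _ (repr_mem r)) r.
split.
  move=> s v mv; have r := repr_scale s (fP _ mv).
  exact: repr_inj (fP _ (repr_mem r)) r.
split.
  move=> v w mv mw; have r := repr_bracket (fP _ mv) (fP _ mw).
  exact: repr_inj (fP _ (repr_mem r)) r.
move=> c _; exists (F c); split; first exact: F_mem.
by apply: (@repr_inj (F c)); first exact: fP (F_mem c).
Qed.

End LinearSymmetries.

(** * Coefficients linear in [u] *)

Lemma upd_comm (K : eqType) (p : K -> R) k l r s : k != l ->
  upd (upd p k r) l s = upd (upd p l s) k r.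
Proof.
move=> ne; apply: functional_extensionality => m; rewrite /upd.
by case: (m =P l) => [->|//]; rewrite eq_sym (negbTE ne).
Qed.

Section AffineCoefficient.
Variables (n : nat) (D : point n -> Prop) (phi : point n -> R).
Variable lambda : ('I_n -> R) -> R.
Hypothesis oD : open D.
Hypothesis fullD : forall p s, D p -> D (upd p None s).
Hypothesis sphi : smooth_on D phi.
Hypothesis aff : affine_in_u D phi lambda (fun=> 0).

Local Notation du := (partial (@None 'I_n)).
Local Notation at1 p := (upd p (@None 'I_n) 1).

(** [lambda] comes with no regularity. It is replaced by [phi] on the slice [u = 1], whose partial
    derivatives are those of the smooth function [phi]. *)
Lemma affine_u_at1 p : D p -> phi p = phi (at1 p) * p None.
Proof.
move=> Dp; rewrite !aff //; last exact: fullD.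
by rewrite /upd /=; ring.
Qed.

Lemma affine_u_upd p s : D p -> phi (upd p None s) = phi (at1 p) * s.
Proof.
by move=> Dp; rewrite affine_u_at1 ?upd_upd ?upd_eq //; apply: fullD.
Qed.

Lemma affine_du p : D p -> du phi p = phi (at1 p).
Proof.
move=> Dp; apply: is_derive_unique.
apply: (is_derive_extR (fun s => phi (at1 p) * s)) => [s|].
  by rewrite [RHS]affine_u_upd.
by auto_derive=> //; ring.
Qed.

Lemma affine_dudu p : D p -> du (du phi) p = 0.
Proof.
move=> Dp; apply: is_derive_unique.
apply: (is_derive_extR (fun=> phi (at1 p))) => [s|]; last exact: is_derive_const.
by rewrite [RHS]affine_du ?upd_upd //; apply: fullD.
Qed.

Lemma affine_d_du i p : D p ->
  partial (Some i) (du phi) p = partial (Some i) phi (at1 p).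
Proof.
move=> Dp; rewrite (partial_ext _ oD affine_du Dp) /partial.
apply: Derive_ext => s; congr phi; exact: upd_comm.
Qed.

Lemma affine_d i p : D p ->
  partial (Some i) phi p = partial (Some i) phi (at1 p) * p None.
Proof.
move=> Dp; rewrite /partial [RHS]Rmult_comm -Derive_scal.
apply: Derive_ext_loc; apply: filter_imp (open_upd (Some i) oD Dp) => s Ds.
rewrite affine_u_at1 // Rmult_comm; congr (_ * _); congr phi; exact: upd_comm.
Qed.

Lemma affine_du_d i p : D p ->
  du (partial (Some i) phi) p = partial (Some i) phi (at1 p).
Proof.
move=> Dp; apply: is_derive_unique.
apply: (is_derive_extR (fun s => partial (Some i) phi (at1 p) * s)) => [s|].
  by rewrite [RHS]affine_d ?upd_upd ?upd_eq //; apply: fullD.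
rewrite -[X in is_derive _ _ X]Rmult_1_r; apply: is_derive_scal.
exact: is_derive_id.
Qed.

Lemma affine_dd i p : D p -> partial (Some i) (partial (Some i) phi) p =
  partial (Some i) (partial (Some i) phi) (at1 p) * p None.
Proof.
move=> Dp; rewrite (partial_ext _ oD (fun q Dq => affine_d i Dq) Dp).
rewrite /partial [RHS]Rmult_comm -Derive_scal.
apply: Derive_ext => s.
by rewrite Rmult_comm -/(partial _ _ _) (@upd_comm _ p (Some i) None s 1).
Qed.

End AffineCoefficient.

Lemma is_derive_zero_const (P : R -> Prop) (f : R -> R) :
  (forall x y z, P x -> P y -> x <= z <= y -> P z) ->
  (forall x, P x -> is_derive f x 0) -> forall x y, P x -> P y -> f x = f y.
Proof.
move=> cP df x y Px Py.
have lt z w : P z -> P w -> z < w -> f z = f w.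
  move=> Pz Pw zw; apply: (@eq_is_derive R_NormedModule) => // t Ht.
  by apply: df; apply: cP Ht.
by case: (Rtotal_order x y) => [|[->//|]] xy; [apply: lt|symmetry; apply: lt].
Qed.

Lemma is_derive_zero_constR (f : R -> R) : (forall x, is_derive f x 0) ->
  forall x y, f x = f y.
Proof. by move=> df x y; apply: (@is_derive_zero_const (fun=> True)). Qed.

Lemma is_derive_zero_const_pos (f : R -> R) :
  (forall x, 0 < x -> is_derive f x 0) ->
  forall x y, 0 < x -> 0 < y -> f x = f y.
Proof. by apply: is_derive_zero_const => x y z; lra. Qed.

(** * The heat equation *)

Section Heat.

Local Notation dt := (partial (Some hT)).
Local Notation dq := (partial (Some hQ)).
Local Notation du := (partial (@None 'I_2)).

Lemma rsum2 (F : 'I_2 -> R) : \rsum_(i < 2) F i = F hT + F hQ.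
Proof.
rewrite !big_ord_recl big_ord0 Rplus_0_r.
by congr (F _ + F _); apply: val_inj.
Qed.

Definition point_tq (t q u : R) : point 2 :=
  fun k => match k with None => u | Some i => if i == hT then t else q end.

Lemma ord2P (i : 'I_2) : i = hT \/ i = hQ.
Proof. by case: i => [[|[|//]] Hi]; [left|right]; apply: val_inj. Qed.

Lemma point_tqE p : p = point_tq (p (Some hT)) (p (Some hQ)) (p None).
Proof.
apply: functional_extensionality; case=> [i|] //=.
by case: (ord2P i) => ->.
Qed.

Definition vf2 (tau xi phi : R -> R -> R -> R) : vfield 2 :=
  fun k p => (match k with
    | None => phi
    | Some i => if i == hT then tau else xi
    end) (p (Some hT)) (p (Some hQ)) (p None).

Section PartialsTQ.
Variable f : point 2 -> R.
Hypothesis sf : smooth_on (fun=> True) f.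

Lemma is_derive_t t q u : is_derive (fun s => f (point_tq s q u)) t
  (partial (Some hT) f (point_tq t q u)).
Proof.
have := @is_derive_partial _ _ f (Some hT) (point_tq t q u) sf I.
apply: is_derive_ext => s; congr f; apply: functional_extensionality.
by case=> [i|] //=; rewrite /upd; case: (ord2P i) => ->.
Qed.

Lemma is_derive_q t q u : is_derive (fun s => f (point_tq t s u)) q
  (partial (Some hQ) f (point_tq t q u)).
Proof.
have := @is_derive_partial _ _ f (Some hQ) (point_tq t q u) sf I.
apply: is_derive_ext => s; congr f; apply: functional_extensionality.
by case=> [i|] //=; rewrite /upd; case: (ord2P i) => ->.
Qed.

Lemma is_derive_tq_u t q u : is_derive (fun s => f (point_tq t q s)) u
  (partial (@None 'I_2) f (point_tq t q u)).
Proof.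
have := @is_derive_partial _ _ f (@None 'I_2) (point_tq t q u) sf I.
apply: is_derive_ext => s; congr f; apply: functional_extensionality.
by case=> [i|] //=; rewrite /upd; case: (ord2P i) => ->.
Qed.

End PartialsTQ.

Lemma pr2_heat v j : (forall k, smooth_on (fun=> True) (v k)) ->
  pr2 v Delta_heat j = pr_u1 v hT j + pr_u2 v hQ hQ j.
Proof.
move=> sv; rewrite /pr2 /sum_coord !rsum2 /=.
have dp k : dj_p k Delta_heat j = 0.
  by rewrite /dj_p /Delta_heat /= Derive_const.
rewrite !dp /dj_u1 /dj_u2 /Delta_heat /upd /= !Derive_const.
have -> : Derive (fun s => s + ju2 j hQ hQ) (ju1 j hT) = 1.
  by apply: is_derive_unique; auto_derive; [|ring].
have -> : Derive (fun s => ju1 j hT + s) (ju2 j hQ hQ) = 1.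
  by apply: is_derive_unique; auto_derive; [|ring].
by ring.
Qed.

Definition jet_tq (p : point 2) (ut uq utt utq uqq : R) : jet 2 :=
  Jet p (fun i => if i == hT then ut else uq)
    (fun i k => if i == hT then if k == hT then utt else utq
                else if k == hT then utq else uqq).

(** On solutions [u_t = - u_qq], while [u_q], [u_tq] and [u_qq] remain free, so the invariance
    condition is a polynomial in them all of whose coefficients vanish. The equations for [phi] are
    stated at [u = 1], which suffices by linearity in [u]. *)
Lemma heat_determining v lambda :
  (forall k, smooth_on (fun=> True) (v k)) ->
  affine_in_u (fun=> True) (v None) lambda (fun=> 0) ->
  is_symmetry (fun=> True) Delta_heat v ->
  let tau := v (Some hT) in let xi := v (Some hQ) in let phi := v None in
  forall p,
  [/\ dq tau p = 0, du tau p = 0, du xi p = 0, 2 * dq xi p = dt tau p &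
   p None = 1 ->
   2 * dq phi p = dt xi p + dq (dq xi) p /\ dt phi p + dq (dq phi) p = 0].
Proof.
move=> sv aff [_ sym] tau xi phi.
have eqn p uq utq uqq :
    dt phi p - uqq * du phi p
    - ((dt tau p - uqq * du tau p) * (- uqq) + (dt xi p - uqq * du xi p) * uq)
    + (dq (dq phi) p + uq * dq (du phi) p
       + uq * (du (dq phi) p + uq * du (du phi) p)
       - ((dq (dq tau) p + uq * dq (du tau) p
           + uq * (du (dq tau) p + uq * du (du tau) p)) * (- uqq)
          + (dq (dq xi) p + uq * dq (du xi) p
             + uq * (du (dq xi) p + uq * du (du xi) p)) * uq)
       + uqq * (du phi p - (du tau p * (- uqq) + du xi p * uq))
       - (utq * (dq tau p + uq * du tau p) + uqq * (dq xi p + uq * du xi p))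
       - ((dq tau p + uq * du tau p) * utq + (dq xi p + uq * du xi p) * uqq)) = 0.
  have := sym (jet_tq p (- uqq) uq 0 utq uqq); rewrite pr2_heat // pr_u1E.
  rewrite (pr_u2E _ _ sv I) !rsum2 /tderiv1 /tderiv2 /= => H.
  apply: etrans _ (H _ I _); first by rewrite /phi /tau /xi; ring.
    by move=> i k; case: (ord2P i) => ->; case: (ord2P k) => ->.
  by rewrite /Delta_heat /=; ring.
(* The terms in [u_tq] are [- 2 u_tq (tau_q + u_q tau_u)]; comparing [u_tq = 0] with [u_tq = 1]
   isolates them, at [u_q = 0] and at [u_q = 1]. *)
have eq_xi p : dq tau p = 0 /\ du tau p = 0.
  have E0 := eqn p 0 0 0; have E1 := eqn p 0 1 0; have E2 := eqn p 1 0 0.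
  have E3 := eqn p 1 1 0; split; lra.
have opT : open (fun _ : point 2 => True) by apply: open_true.
have qf (q : point 2) (r : R) : True -> True by [].
have tau_qq p : dq (dq tau) p = 0.
  exact: (partial_indep _ opT (sv _) (fun _ _ _ => I) (fun p _ => (eq_xi p).1) I).
have tau_uq p : dq (du tau) p = 0.
  by rewrite (partial_ext _ opT (fun q _ => (eq_xi q).2) I) /partial Derive_const.
have tau_qu p : du (dq tau) p = 0.
  exact: (partial_indep _ opT (sv _) (fun _ _ _ => I) (fun p _ => (eq_xi p).2) I).
have tau_uu p : du (du tau) p = 0.
  exact: (partial_indep _ opT (sv _) (fun _ _ _ => I) (fun p _ => (eq_xi p).2) I).
(* Now that [tau_q] and [tau_u] vanish, the terms in [u_qq] reduce to
   [u_qq (tau_t - 2 xi_q - 2 u_q xi_u)]; those with [phi_u] cancel. *)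
have xi_u p : du xi p = 0 /\ 2 * dq xi p = dt tau p.
  have := eqn p 0 0 0; have := eqn p 0 0 1; have := eqn p 1 0 0.
  have := eqn p 1 0 1.
  rewrite tau_qq tau_uq tau_qu tau_uu (eq_xi p).1 (eq_xi p).2; split; lra.
have xi_uq p : dq (du xi) p = 0.
  by rewrite (partial_ext _ opT (fun q _ => (xi_u q).1) I) /partial Derive_const.
have xi_uu p : du (du xi) p = 0.
  exact: (partial_indep _ opT (sv _) (fun _ _ _ => I) (fun p _ => (xi_u p).1) I).
have xi_qu p : du (dq xi) p = 0.
  exact: (partial_indep _ opT (sv _) (fun _ _ _ => I) (fun p _ => (xi_u p).1) I).
move=> p; have [tau_q tau_u] := eq_xi p; have [du_xi dq_xi] := xi_u p.
split=> // u1; have pE : upd p None 1 = p by rewrite -{2}(upd_same p None) u1.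
have phi_u : du phi p = phi p by rewrite (affine_du qf aff I) pE.
have phi_uu : du (du phi) p = 0 by rewrite (affine_dudu qf aff I).
have phi_uq : dq (du phi) p = dq phi p by rewrite (affine_d_du opT qf aff _ I) pE.
have phi_qu : du (dq phi) p = dq phi p by rewrite (affine_du_d opT qf aff _ I) pE.
have E0 := eqn p 0 0 0; have E1 := eqn p 1 0 0.
rewrite tau_q tau_u du_xi tau_qq tau_uq tau_qu tau_uu xi_uq xi_uu xi_qu in E0 E1.
by rewrite phi_u phi_uu phi_uq phi_qu in E0 E1; split; lra.
Qed.

(** * Explicit symmetries of the heat equation *)

(** Here the domain is the whole space, so partial derivatives of explicit coefficients are
    equalities of functions and can be rewritten inside further derivatives. *)
Definition fun_tq (g : R -> R -> R -> R) (p : point 2) : R :=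
  g (p (Some hT)) (p (Some hQ)) (p None).

Lemma dt_fun_tq g g' :
  (forall t q u, is_derive (fun s => g s q u) t (g' t q u)) ->
  dt (fun_tq g) = fun_tq g'.
Proof.
by move=> dg; apply: functional_extensionality => p; apply: is_derive_unique (dg _ _ _).
Qed.

Lemma dq_fun_tq g g' :
  (forall t q u, is_derive (fun s => g t s u) q (g' t q u)) ->
  dq (fun_tq g) = fun_tq g'.
Proof.
by move=> dg; apply: functional_extensionality => p; apply: is_derive_unique (dg _ _ _).
Qed.

Lemma du_fun_tq g g' :
  (forall t q u, is_derive (fun s => g t q s) u (g' t q u)) ->
  du (fun_tq g) = fun_tq g'.
Proof.
by move=> dg; apply: functional_extensionality => p; apply: is_derive_unique (dg _ _ _).
Qed.

(** [E] and [X] are the translations in [t] and [q], [Y] is the Galilean boost, [H] the scaling, [F]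
    the projective transformation. The normalization follows [M]: [[X, Y] = Z] forces
    [Z = (u/2) d/du], and [[E, F] = H] forces the summand [c gH / 2]. *)
Definition heat_field (c : Mgen -> R) : vfield 2 := vf2
  (fun t q u => c gE - 2 * c gH * t - c gF * t ^ 2)
  (fun t q u => c gX + c gY * t - c gH * q - c gF * t * q)
  (fun t q u => (c gZ / 2 + c gH / 2 + c gY / 2 * q
                 - c gF * (q ^ 2 / 4 - t / 2)) * u).

Ltac heat_partial := (apply: dt_fun_tq || apply: dq_fun_tq || apply: du_fun_tq);
  move=> t q u; auto_derive=> //=; field.

Lemma heat_field_partials c :
  let tau := heat_field c (Some hT) in let xi := heat_field c (Some hQ) in
  let phi := heat_field c None in
  ((dt tau = fun_tq (fun t _ _ => - 2 * c gH - 2 * c gF * t))%R *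
  (dq tau = fun_tq (fun _ _ _ => 0))%R *
  (du tau = fun_tq (fun _ _ _ => 0))%R *
  (dt xi = fun_tq (fun _ q _ => c gY - c gF * q))%R *
  (dq xi = fun_tq (fun t _ _ => - c gH - c gF * t))%R *
  (du xi = fun_tq (fun _ _ _ => 0))%R *
  (dt phi = fun_tq (fun _ _ u => c gF / 2 * u))%R *
  (dq phi = fun_tq (fun _ q u => (c gY / 2 - c gF * q / 2) * u))%R *
  (du phi = fun_tq (fun t q _ => c gZ / 2 + c gH / 2 + c gY / 2 * q
                 - c gF * (q ^ 2 / 4 - t / 2)))%R)%type.
Proof.
move=> tau xi phi.
have -> : tau = fun_tq (fun t q u => c gE - 2 * c gH * t - c gF * t ^ 2) by [].
have -> : xi = fun_tq (fun t q u => c gX + c gY * t - c gH * q - c gF * t * q).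
  by [].
have -> : phi = fun_tq (fun t q u => (c gZ / 2 + c gH / 2 + c gY / 2 * q
                 - c gF * (q ^ 2 / 4 - t / 2)) * u) by [].
repeat split; heat_partial.
Qed.

Lemma open_full K : open (fun _ : K -> R => True).
Proof. exact: open_true. Qed.

Lemma heat_field_smooth c k : smooth_on (fun=> True) (heat_field c k).
Proof.
apply: elementary_smooth (@open_full _) _; rewrite /heat_field /vf2.
by case: k => [i|]; [case: (i == hT)|]; elementary_tac.
Qed.

Lemma heat_field_mem c : is_linear_symmetry (fun=> True) Delta_heat (heat_field c).
Proof.
have sF := heat_field_smooth c.
split; last first.
  exists (fun x => c gZ / 2 + c gH / 2 + c gY / 2 * x hQ
                 - c gF * (x hQ ^ 2 / 4 - x hT / 2)) => p _.
  by rewrite /heat_field /vf2; ring.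
split=> // j _ _ D0; rewrite pr2_heat // pr_u1E (pr_u2E _ _ sF I) !rsum2.
have {D0} E : ju1 j hT = - ju2 j hQ hQ by move: D0; rewrite /Delta_heat; lra.
rewrite /tderiv1 /tderiv2 !heat_field_partials.
have du0 : du (fun_tq (fun _ _ _ => 0)) = fun_tq (fun _ _ _ => 0) by heat_partial.
have dq0 : dq (fun_tq (fun _ _ _ => 0)) = fun_tq (fun _ _ _ => 0) by heat_partial.
have -> : dq (fun_tq (fun _ q u => (c gY / 2 - c gF * q / 2) * u)) =
          fun_tq (fun _ q u => - c gF / 2 * u) by heat_partial.
have -> : du (fun_tq (fun _ q u => (c gY / 2 - c gF * q / 2) * u)) =
          fun_tq (fun _ q u => c gY / 2 - c gF * q / 2) by heat_partial.
have -> : dq (fun_tq (fun t q _ => c gZ / 2 + c gH / 2 + c gY / 2 * q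
                 - c gF * (q ^ 2 / 4 - t / 2))) =
          fun_tq (fun _ q u => c gY / 2 - c gF * q / 2) by heat_partial.
have -> : du (fun_tq (fun t q _ => c gZ / 2 + c gH / 2 + c gY / 2 * q
                 - c gF * (q ^ 2 / 4 - t / 2))) =
          fun_tq (fun _ _ _ => 0) by heat_partial.
have -> : dq (fun_tq (fun t _ _ => - c gH - c gF * t)) =
          fun_tq (fun _ _ _ => 0) by heat_partial.
have -> : du (fun_tq (fun t _ _ => - c gH - c gF * t)) =
          fun_tq (fun _ _ _ => 0) by heat_partial.
by rewrite !du0 !dq0 /fun_tq E; field.
Qed.

Lemma heat_field_bracket c c' : vf_eq (fun=> True)
  (heat_field (M_bracket c c')) (vf_bracket (heat_field c) (heat_field c')).
Proof.
move=> k p _; rewrite /vf_bracket /sum_coord rsum2.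
have [->|[->|->]] : k = Some hT \/ k = Some hQ \/ k = None.
- by case: k => [i|]; [case: (ord2P i) => ->|]; auto.
- rewrite !heat_field_partials /fun_tq /heat_field /vf2 /= !M_bracketE; field.
- rewrite !heat_field_partials /fun_tq /heat_field /vf2 /= !M_bracketE; field.
- rewrite !heat_field_partials /fun_tq /heat_field /vf2 /= !M_bracketE; field.
Qed.

Lemma heat_field_inj c : vf_eq (fun=> True) (heat_field c) (@vf_zero 2) ->
  forall k, c k = 0.
Proof.
move=> H.
have T (t q u : R) : c gE - 2 * c gH * t - c gF * t ^ 2 = 0.
  by have := H (Some hT) (point_tq t q u) I; rewrite /heat_field /vf2 /vf_zero /=.
have X (t q u : R) : c gX + c gY * t - c gH * q - c gF * t * q = 0.
  by have := H (Some hQ) (point_tq t q u) I; rewrite /heat_field /vf2 /vf_zero /=.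
have U (t q u : R) : (c gZ / 2 + c gH / 2 + c gY / 2 * q
                 - c gF * (q ^ 2 / 4 - t / 2)) * u = 0.
  by have := H None (point_tq t q u) I; rewrite /heat_field /vf2 /vf_zero /=.
have := T 0 0 0; have := T 1 0 0; have := T (-1) 0 0.
have := X 0 0 0; have := X 1 0 0; have := U 0 0 1 => ? ? ? ? ? ?.
by case; lra.
Qed.

(** The determining equations integrate in turn to [tau = T(t)], [xi = B(t) + T' q / 2] and, at
    [u = 1], [phi = l0(t) + B' q / 2 + T'' q^2 / 8]. The heat equation for [phi] leaves ordinary
    differential equations with polynomial solutions. *)
Lemma heat_field_onto v : is_linear_symmetry (fun=> True) Delta_heat v ->
  exists c, vf_eq (fun=> True) v (heat_field c).
Proof.
move=> [[sv sym] [lambda aff]].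
have det := heat_determining sv aff (conj sv sym).
set tau := v (Some hT) in det; set xi := v (Some hQ) in det.
set phi := v None in det.
have tau_q p : dq tau p = 0 by have [] := det p.
have tau_u p : du tau p = 0 by have [] := det p.
have xi_u p : du xi p = 0 by have [] := det p.
have xi_q p : 2 * dq xi p = dt tau p by have [] := det p.
have phiE t q u : phi (point_tq t q u) = phi (point_tq t q 1) * u.
  by rewrite /phi !aff //=; ring.
have phi_q t q : 2 * dq phi (point_tq t q 1) =
    dt xi (point_tq t q 1) + dq (dq xi) (point_tq t q 1).
  by have [_ _ _ _ /(_ erefl)[]] := det (point_tq t q 1).
have phi_t t q : dt phi (point_tq t q 1) + dq (dq phi) (point_tq t q 1) = 0.
  by have [_ _ _ _ /(_ erefl)[]] := det (point_tq t q 1).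
have st := sv (Some hT); rewrite -/tau in st.
have sx := sv (Some hQ); rewrite -/xi in sx.
have sp := sv None; rewrite -/phi in sp.
pose T t := tau (point_tq t 0 0).
pose T1 t := dt tau (point_tq t 0 0).
pose T2 t := dt (dt tau) (point_tq t 0 0).
pose T3 t := dt (dt (dt tau)) (point_tq t 0 0).
have dT t : is_derive T t (T1 t) by apply: is_derive_t.
have dT1 t : is_derive T1 t (T2 t).
  exact: (is_derive_t (smooth_on_partial _ st)).
have dT2 t : is_derive T2 t (T3 t).
  exact: (is_derive_t (smooth_on_partial _ (smooth_on_partial _ st))).
have tauE t q u : tau (point_tq t q u) = T t.
  rewrite (is_derive_zero_constR _ q 0 (f := fun q => tau (point_tq t q u))).
    apply: (is_derive_zero_constR _ u 0 (f := fun u => tau (point_tq t 0 u))) => s.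
    exact: is_derive_eq (is_derive_tq_u st _ _ _) (tau_u _).
  by move=> s; exact: is_derive_eq (is_derive_q st _ _ _) (tau_q _).
have tau_tE t q u : dt tau (point_tq t q u) = T1 t.
  rewrite -(is_derive_unique _ _ _ (is_derive_t st t q u)).
  apply: is_derive_unique; apply: is_derive_extR (dT t) => s.
  by rewrite tauE.
pose B t := xi (point_tq t 0 0).
pose B1 t := dt xi (point_tq t 0 0).
pose B2 t := dt (dt xi) (point_tq t 0 0).
have dB t : is_derive B t (B1 t) by apply: is_derive_t.
have dB1 t : is_derive B1 t (B2 t).
  exact: (is_derive_t (smooth_on_partial _ sx)).
have xiE t q u : xi (point_tq t q u) = B t + T1 t * q / 2.
  rewrite (is_derive_zero_constR _ u 0 (f := fun u => xi (point_tq t q u))); last first.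
    by move=> s; exact: is_derive_eq (is_derive_tq_u sx _ _ _) (xi_u _).
  have := @is_derive_zero_constR (fun q => xi (point_tq t q 0) - T1 t * q / 2) _ q 0.
  rewrite /B => E; suff : xi (point_tq t q 0) - T1 t * q / 2 =
    xi (point_tq t 0 0) - T1 t * 0 / 2 by lra.
  apply: E => s; apply: is_derive_eq (_ : _ - T1 t / 2 = 0).
    apply: is_derive_minus; first exact: (is_derive_q sx).
    by auto_derive=> //; lra.
  by have := xi_q (point_tq t s 0); rewrite tau_tE; lra.
have xi_tE t q u : dt xi (point_tq t q u) = B1 t + T2 t * q / 2.
  rewrite -(is_derive_unique _ _ _ (is_derive_t sx t q u)).
  apply: is_derive_unique.
  apply: (is_derive_extR (fun s => B s + T1 s * q / 2)) => [s|]; first by rewrite xiE.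
  apply: is_derive_plus => //.
  have -> : T2 t * q / 2 = (q / 2) * T2 t by field.
  apply: (is_derive_extR (fun s => (q / 2) * T1 s)) => [s|].
    by rewrite /Rdiv Rmult_comm Rmult_assoc.
  exact: is_derive_scal.
have xi_qqE t q u : dq (dq xi) (point_tq t q u) = 0.
  rewrite -(is_derive_unique _ _ _ (is_derive_q (smooth_on_partial _ sx) t q u)).
  apply: is_derive_unique; apply: (is_derive_extR (fun=> T1 t / 2)) => [s|].
    by have := xi_q (point_tq t s u); rewrite tau_tE => <-; field.
  exact: is_derive_const.
pose l0 t := phi (point_tq t 0 1).
pose l1 t := dt phi (point_tq t 0 1).
have dl0 t : is_derive l0 t (l1 t) by apply: is_derive_t.
have phi1E t q : phi (point_tq t q 1) = l0 t + B1 t * q / 2 + T2 t * q ^ 2 / 8.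
  have := @is_derive_zero_constR (fun q => phi (point_tq t q 1)
    - (B1 t * q / 2 + T2 t * q ^ 2 / 8)) _ q 0.
  rewrite /l0 => E; suff : phi (point_tq t q 1) - (B1 t * q / 2 + T2 t * q ^ 2 / 8)
    = phi (point_tq t 0 1) - (B1 t * 0 / 2 + T2 t * 0 ^ 2 / 8) by lra.
  apply: E => s; apply: is_derive_eq (_ : _ - (B1 t / 2 + T2 t * s / 4) = 0).
    apply: is_derive_minus; first exact: (is_derive_q sp).
    by auto_derive=> //; lra.
  by have := phi_q t s; rewrite xi_tE xi_qqE; lra.
have phi_tE t q : dt phi (point_tq t q 1) = l1 t + B2 t * q / 2 + T3 t * q ^ 2 / 8.
  rewrite -(is_derive_unique _ _ _ (is_derive_t sp t q 1)).
  apply: is_derive_unique.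
  apply: (is_derive_extR (fun s => l0 s + (q / 2) * B1 s + (q ^ 2 / 8) * T2 s)).
    by move=> s; rewrite phi1E; congr (_ + _ + _); rewrite /Rdiv; ring.
  have -> : l1 t + B2 t * q / 2 + T3 t * q ^ 2 / 8 =
            l1 t + (q / 2) * B2 t + (q ^ 2 / 8) * T3 t by field.
  apply: is_derive_plus; last exact: is_derive_scal.
  by apply: is_derive_plus => //; apply: is_derive_scal.
have phi_qqE t q : dq (dq phi) (point_tq t q 1) = T2 t / 4.
  rewrite -(is_derive_unique _ _ _ (is_derive_q (smooth_on_partial _ sp) t q 1)).
  apply: is_derive_unique.
  apply: (is_derive_extR (fun s => (B1 t + T2 t * s / 2) / 2)) => [s|].
    by have := phi_q t s; rewrite xi_tE xi_qqE Rplus_0_r => <-; field.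
  by auto_derive=> //; field.
(* Substitution in [phi_t + phi_qq = 0] gives a polynomial of degree at most two in [q], determined
   by its values at [0], [1] and [-1]. *)
have ode t : T3 t = 0 /\ B2 t = 0 /\ l1 t = - T2 t / 4.
  have E q : l1 t + B2 t * q / 2 + T3 t * q ^ 2 / 8 + T2 t / 4 = 0.
    by rewrite -phi_tE -(phi_qqE t q).
  by have := E 0; have := E 1; have := E (-1); lra.
have T2E t : T2 t = T2 0.
  by apply: is_derive_zero_constR => s; rewrite -(ode s).1.
have B1E t : B1 t = B1 0.
  by apply: is_derive_zero_constR => s; rewrite -(ode s).2.1.
have primitive (f : R -> R) (a b : R) :
    (forall s, is_derive f s (a + b * s)) -> forall t, f t = f 0 + a * t + b * t ^ 2 / 2.
  move=> df t.
  suff : f t - (a * t + b * t ^ 2 / 2) = f 0 - (a * 0 + b * 0 ^ 2 / 2) by lra.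
  apply: (@is_derive_zero_constR (fun t => f t - (a * t + b * t ^ 2 / 2))) => s.
  apply: is_derive_eq (_ : (a + b * s) - (a + b * s) = 0); last by ring.
  by apply: is_derive_minus => //; auto_derive=> //; field.
have T1E t : T1 t = T1 0 + T2 0 * t.
  rewrite (primitive T1 (T2 0) 0); first by field.
  by move=> s; rewrite Rmult_0_l Rplus_0_r -(T2E s).
have TE t : T t = T 0 + T1 0 * t + T2 0 * t ^ 2 / 2.
  by apply: primitive => s; rewrite -T1E.
have BE t : B t = B 0 + B1 0 * t.
  rewrite (primitive B (B1 0) 0); first by field.
  by move=> s; rewrite Rmult_0_l Rplus_0_r -(B1E s).
have l0E t : l0 t = l0 0 - T2 0 / 4 * t.
  rewrite (primitive l0 (- T2 0 / 4) 0); first by field.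
  by move=> s; rewrite Rmult_0_l Rplus_0_r -(T2E s) -(ode s).2.2.
(* Taylor coefficients at [t = 0] are matched: [T' = - 2 c_H] and [T'' = - 2 c_F] there. The
   constant term of [phi] at [u = 1] is [c_Z / 2 + c_H / 2], whence the correction [T1 0 / 2] in
   [c_Z]. *)
exists (fun k => match k with
  | gE => T 0 | gH => - T1 0 / 2 | gF => - T2 0 / 2
  | gX => B 0 | gY => B1 0 | gZ => 2 * l0 0 + T1 0 / 2 end).
move=> k p _; rewrite (point_tqE p).
set t := p _; set q := p (Some hQ); set u := p None.
have [->|[->|->]] : k = Some hT \/ k = Some hQ \/ k = None.
- by case: k => [i|]; [case: (ord2P i) => ->|]; auto.
- by rewrite [LHS]tauE TE /heat_field /vf2 /=; field.
- by rewrite [LHS]xiE BE T1E /heat_field /vf2 /=; field.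
- by rewrite [LHS]phiE phi1E l0E B1E T2E /heat_field /vf2 /=; field.
Qed.

Lemma lie_isomorphic_M_H00 : lie_isomorphic M H00.
Proof.
apply: (@lie_isomorphic_M_symmetries _ _ _ (@open_full _) heat_field).
- exact: heat_field_mem.
- exact: heat_field_onto.
- move=> c c' k p _; rewrite /vf_add /heat_field /vf2.
  by case: k => [i|]; [case: (i == hT)|]; field.
- move=> r c k p _; rewrite /vf_scale /heat_field /vf2.
  by case: k => [i|]; [case: (i == hT)|]; field.
- exact: heat_field_inj.
- exact: heat_field_bracket.
Qed.

End Heat.

(** * The equation in (x, y, t) *)

Section XYT.

Local Notation dx := (partial (Some iX)).
Local Notation dy := (partial (Some iY)).
Local Notation dt := (partial (Some iT)).
Local Notation du := (partial (@None 'I_3)).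

Lemma rsum3 (F : 'I_3 -> R) : \rsum_(i < 3) F i = F iX + F iY + F iT.
Proof.
rewrite !big_ord_recl big_ord0 Rplus_0_r Rplus_assoc.
by congr (F _ + (F _ + F _)); apply: val_inj.
Qed.

Lemma ord3P (i : 'I_3) : [\/ i = iX, i = iY | i = iT].
Proof.
by case: i => [[|[|[|//]]] Hi];
  [constructor 1|constructor 2|constructor 3]; apply: val_inj.
Qed.

Lemma open_quadrant : open quadrant.
Proof.
move=> p [px py].
have m0 : 0 < Rmin (p (Some iX)) (p (Some iY)) by apply: Rmin_glb_lt.
exists (mkposreal _ m0) => q Hq.
have := Hq (Some iX); have := Hq (Some iY).
rewrite /ball /= /AbsRing_ball /= /abs /minus /plus /opp /=.
have := Rmin_l (p (Some iX)) (p (Some iY)).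
have := Rmin_r (p (Some iX)) (p (Some iY)) => h1 h2 h3 h4.
by split; [have := Rabs_def2 _ _ h4|have := Rabs_def2 _ _ h3]; lra.
Qed.

Lemma quadrant_upd_u p s : quadrant p -> quadrant (upd p None s).
Proof. by []. Qed.

(** * The invariance condition in (x, y, t) *)

Lemma pr2_xyt a b d e v j :
  pr2 v (Delta_xyt a b d e) j =
  v (Some iX) (jp j) * (- b * ju1 j iX + ju2 j iX iX / 2)
  + v (Some iY) (jp j) * (- e * ju1 j iY + ju2 j iY iY / 2)
  + (a - b * jp j (Some iX)) * pr_u1 v iX j
  + (d - e * jp j (Some iY)) * pr_u1 v iY j + pr_u1 v iT j
  + jp j (Some iX) / 2 * pr_u2 v iX iX j
  + jp j (Some iY) / 2 * pr_u2 v iY iY j.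
Proof.
set Dl := Delta_xyt a b d e.
have pX : dj_p (Some iX) Dl j = - b * ju1 j iX + ju2 j iX iX / 2.
  by rewrite /dj_p /Dl /Delta_xyt /upd /=; apply: is_derive_unique;
    auto_derive=> //; field.
have pY : dj_p (Some iY) Dl j = - e * ju1 j iY + ju2 j iY iY / 2.
  by rewrite /dj_p /Dl /Delta_xyt /upd /=; apply: is_derive_unique;
    auto_derive=> //; field.
have pT : dj_p (Some iT) Dl j = 0.
  by rewrite /dj_p /Dl /Delta_xyt /upd /=; apply: Derive_const.
have pU : dj_p None Dl j = 0.
  by rewrite /dj_p /Dl /Delta_xyt /upd /=; apply: Derive_const.
have uX : dj_u1 iX Dl j = a - b * jp j (Some iX).
  by rewrite /dj_u1 /Dl /Delta_xyt /upd /=; apply: is_derive_unique;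
    auto_derive=> //; field.
have uY : dj_u1 iY Dl j = d - e * jp j (Some iY).
  by rewrite /dj_u1 /Dl /Delta_xyt /upd /=; apply: is_derive_unique;
    auto_derive=> //; field.
have uT : dj_u1 iT Dl j = 1.
  by rewrite /dj_u1 /Dl /Delta_xyt /upd /=; apply: is_derive_unique;
    auto_derive=> //; field.
have uXX : dj_u2 iX iX Dl j = jp j (Some iX) / 2.
  by rewrite /dj_u2 /Dl /Delta_xyt /=; apply: is_derive_unique;
    auto_derive=> //; field.
have uYY : dj_u2 iY iY Dl j = jp j (Some iY) / 2.
  by rewrite /dj_u2 /Dl /Delta_xyt /=; apply: is_derive_unique;
    auto_derive=> //; field.
have u0 i k : i != k -> dj_u2 i k Dl j = 0.
  move=> ne; rewrite /dj_u2 /Dl /Delta_xyt -[RHS](Derive_const (Dl j) (ju2 j i k)).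
  apply: Derive_ext => s /=.
  have z l : ((l == i) && (l == k) || (l == k) && (l == i)) = false.
    by case: (l =P i) => [->|]; rewrite ?andbF // (negbTE ne).
  by rewrite !z.
have uTT : dj_u2 iT iT Dl j = 0.
  by rewrite /dj_u2 /Dl /Delta_xyt /=; apply: Derive_const.
rewrite /pr2 /sum_coord !rsum3 /= pX pY pT pU uX uY uT uXX uYY uTT.
by rewrite !u0 //; ring.
Qed.

Lemma partial_zero (K : eqType) (D : (K -> R) -> Prop) f k p : open D ->
  (forall q, D q -> f q = 0) -> D p -> partial k f p = 0.
Proof.
by move=> oD f0 Dp; rewrite (partial_ext k oD f0 Dp); apply: Derive_const.
Qed.

(** With [u_t] eliminated through [Delta = 0], the condition has degree one in [u_xx], [u_yy],
    [u_xy], [u_x], [u_y] and [u]. This normal form serves both ways: its coefficients give the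
    determining equations, and explicit fields are checked against it. Derivatives of [phi] at
    [u = 1] stand for those of the factor of [u] in [phi]. *)
Lemma pr2_xyt_reduced a b d e v lambda j :
  (forall k, smooth_on quadrant (v k)) ->
  affine_in_u quadrant (v None) lambda (fun=> 0) ->
  let xi := v (Some iX) in let gam := v (Some iY) in let tau := v (Some iT) in
  let phi := v None in
  (forall q, quadrant q -> du xi q = 0) -> (forall q, quadrant q -> du gam q = 0) ->
  (forall q, quadrant q -> du tau q = 0) ->
  (forall q, quadrant q -> dx tau q = 0) -> (forall q, quadrant q -> dy tau q = 0) ->
  is_jet j -> quadrant (jp j) -> Delta_xyt a b d e j = 0 ->
  let p := jp j in let p1 := upd p None 1 in
  let x := p (Some iX) in let y := p (Some iY) in
  pr2 v (Delta_xyt a b d e) j =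
    ju2 j iX iX * (xi p / 2 - x * dx xi p + dt tau p * x / 2)
  + ju2 j iY iY * (gam p / 2 - y * dy gam p + dt tau p * y / 2)
  - ju2 j iX iY * (x * dx gam p + y * dy xi p)
  + ju1 j iX * (- b * xi p + x * dx phi p1
      - ((a - b * x) * dx xi p + (d - e * y) * dy xi p + dt xi p)
      - (x / 2 * dx (dx xi) p + y / 2 * dy (dy xi) p) + dt tau p * (a - b * x))
  + ju1 j iY * (- e * gam p + y * dy phi p1
      - ((a - b * x) * dx gam p + (d - e * y) * dy gam p + dt gam p)
      - (x / 2 * dx (dx gam) p + y / 2 * dy (dy gam) p) + dt tau p * (d - e * y))
  + p None * (dt phi p1 + (a - b * x) * dx phi p1 + (d - e * y) * dy phi p1
      + x / 2 * dx (dx phi) p1 + y / 2 * dy (dy phi) p1).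
Proof.
move=> sv aff xi gam tau phi xi_u gam_u tau_u tau_x tau_y sj Dp D0 p p1 x y.
have oQ := open_quadrant.
have Z2 f k l : (forall q, quadrant q -> partial l f q = 0) -> partial k (partial l f) p = 0.
  by move=> H; apply: partial_zero oQ H Dp.
have ZI f k : smooth_on quadrant f -> (forall q, quadrant q -> du f q = 0) ->
    du (partial k f) p = 0.
  by move=> sf H; apply: partial_indep oQ sf _ H Dp.
have sx : smooth_on quadrant xi := sv _.
have sg : smooth_on quadrant gam := sv _.
rewrite pr2_xyt !pr_u1E !(pr_u2E _ _ sv Dp) !rsum3 /tderiv1 /tderiv2.
rewrite -/xi -/gam -/tau -/phi -/p -/x -/y.
rewrite (xi_u p) // (gam_u p) // (tau_u p) // (tau_x p) // (tau_y p) //.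
rewrite !(Z2 _ _ _ xi_u) !(Z2 _ _ _ gam_u) !(Z2 _ _ _ tau_u).
rewrite !(Z2 _ _ _ tau_x) !(Z2 _ _ _ tau_y).
rewrite !(ZI _ _ sx xi_u) !(ZI _ _ sg gam_u).
have qf q s : quadrant q -> quadrant (upd q None s) by [].
rewrite (affine_du qf aff Dp) (affine_dudu qf aff Dp).
rewrite !(affine_d_du oQ qf aff _ Dp) !(affine_du_d oQ qf aff _ Dp).
rewrite (affine_dd oQ qf aff iX Dp) (affine_dd oQ qf aff iY Dp).
rewrite (affine_d oQ qf aff iX Dp) (affine_d oQ qf aff iY Dp).
rewrite (affine_d oQ qf aff iT Dp).
rewrite -/phi -/p -/p1 (sj iY iX).
have E : ju1 j iT = - ((a - b * x) * ju1 j iX + (d - e * y) * ju1 j iY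
  + x / 2 * ju2 j iX iX + y / 2 * ju2 j iY iY).
  by move: D0; rewrite /Delta_xyt -/p -/x -/y; lra.
by rewrite E /=; field.
Qed.

(** The entry [u_tt] is set to 0, since the invariance condition contains [phi^xx] and [phi^yy] but
    not [phi^tt], [phi^xt] or [phi^yt]. *)
Definition jet_xyt (p : point 3) (ux uy ut uxx uyy uxy uxt uyt : R) : jet 3 :=
  Jet p (fun i => if i == iX then ux else if i == iY then uy else ut)
    (fun i k =>
       if i == iX then if k == iX then uxx else if k == iY then uxy else uxt
       else if i == iY then if k == iX then uxy else if k == iY then uyy else uyt
       else if k == iX then uxt else if k == iY then uyt else 0).

Lemma is_jet_xyt p ux uy ut uxx uyy uxy uxt uyt :
  is_jet (jet_xyt p ux uy ut uxx uyy uxy uxt uyt).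
Proof. by move=> i k; case: (ord3P i) => ->; case: (ord3P k) => ->. Qed.

(** [Delta] does not contain the mixed coordinates, so they can be varied without leaving
    [Delta = 0]. Their contribution to the condition, split off here, must therefore vanish
    identically in them. *)
Lemma pr2_xyt_mixed a b d e v p ux uy ut uxy uxt uyt :
  (forall k, smooth_on quadrant (v k)) -> quadrant p ->
  pr2 v (Delta_xyt a b d e) (jet_xyt p ux uy ut 0 0 uxy uxt uyt) =
  pr2 v (Delta_xyt a b d e) (jet_xyt p ux uy ut 0 0 0 0 0)
  - uxt * (p (Some iX) * (dx (v (Some iT)) p + ux * du (v (Some iT)) p))
  - uyt * (p (Some iY) * (dy (v (Some iT)) p + uy * du (v (Some iT)) p))
  - uxy * (p (Some iX) * (dx (v (Some iY)) p + ux * du (v (Some iY)) p)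
           + p (Some iY) * (dy (v (Some iX)) p + uy * du (v (Some iX)) p)).
Proof.
move=> sv Dp; rewrite !pr2_xyt !pr_u1E !(pr_u2E _ _ sv) // !rsum3.
by rewrite /tderiv1 /tderiv2 /=; field.
Qed.

Lemma mul_pos_eq0 x z : 0 < x -> x * z = 0 -> z = 0.
Proof. by move=> x0 /Rmult_integral[]; lra. Qed.

Lemma xyt_determining a b d e v lambda :
  (forall k, smooth_on quadrant (v k)) ->
  affine_in_u quadrant (v None) lambda (fun=> 0) ->
  is_symmetry quadrant (Delta_xyt a b d e) v ->
  let xi := v (Some iX) in let gam := v (Some iY) in let tau := v (Some iT) in
  let phi := v None in
  forall p, quadrant p ->
  let x := p (Some iX) in let y := p (Some iY) in
  [/\ [/\ du xi p = 0, du gam p = 0, du tau p = 0, dx tau p = 0 & dy tau p = 0],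
      x * dx gam p + y * dy xi p = 0,
      2 * x * dx xi p = xi p + x * dt tau p,
      2 * y * dy gam p = gam p + y * dt tau p &
  p None = 1 ->
  [/\ x * dx phi p = b * xi p
        + ((a - b * x) * dx xi p + (d - e * y) * dy xi p + dt xi p)
        + (x / 2 * dx (dx xi) p + y / 2 * dy (dy xi) p) - dt tau p * (a - b * x),
      y * dy phi p = e * gam p
        + ((a - b * x) * dx gam p + (d - e * y) * dy gam p + dt gam p)
        + (x / 2 * dx (dx gam) p + y / 2 * dy (dy gam) p) - dt tau p * (d - e * y)
    & dt phi p + (a - b * x) * dx phi p + (d - e * y) * dy phi p
      + x / 2 * dx (dx phi) p + y / 2 * dy (dy phi) p = 0]].
Proof.
move=> sv aff [_ sym] xi gam tau phi.
(* Proved at every point of the quadrant, because [pr2_xyt_reduced] also needs the derivatives of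
   these functions to vanish. *)
have base p : quadrant p ->
    [/\ du xi p = 0, du gam p = 0, du tau p = 0, dx tau p = 0 & dy tau p = 0].
  move=> Dp.
  have px : 0 < p (Some iX) := Dp.1; have py : 0 < p (Some iY) := Dp.2.
  (* Difference of the conditions at two jets, with and without mixed coordinates; [ut] puts both on
     [Delta = 0]. *)
  have E ux uy uxy uxt uyt :
    uxt * (p (Some iX) * (dx tau p + ux * du tau p))
    + uyt * (p (Some iY) * (dy tau p + uy * du tau p))
    + uxy * (p (Some iX) * (dx gam p + ux * du gam p)
             + p (Some iY) * (dy xi p + uy * du xi p)) = 0.
    pose ut := - ((a - b * p (Some iX)) * ux + (d - e * p (Some iY)) * uy).
    have D0 r s w : Delta_xyt a b d e (jet_xyt p ux uy ut 0 0 r s w) = 0.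
      by rewrite /Delta_xyt /= /ut; field.
    have := sym _ (is_jet_xyt p ux uy ut 0 0 uxy uxt uyt) Dp (D0 _ _ _).
    rewrite pr2_xyt_mixed // (sym _ (is_jet_xyt _ _ _ _ _ _ _ _ _) Dp (D0 _ _ _)).
    by rewrite -/tau -/gam -/xi; lra.
  split.
  - apply: (mul_pos_eq0 py); have := E 0 1 1 0 0; have := E 0 0 1 0 0; lra.
  - apply: (mul_pos_eq0 px); have := E 1 0 1 0 0; have := E 0 0 1 0 0; lra.
  - apply: (mul_pos_eq0 px); have := E 1 0 0 1 0; have := E 0 0 0 1 0; lra.
  - apply: (mul_pos_eq0 px); have := E 0 0 0 1 0; lra.
  - apply: (mul_pos_eq0 py); have := E 0 0 0 0 1; lra.
move=> p Dp x y; have px : 0 < x := Dp.1; have py : 0 < y := Dp.2.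
have red j (sj : is_jet j) (Dj : quadrant (jp j)) D0 := etrans (esym (sym j sj Dj D0))
  (@pr2_xyt_reduced a b d e v lambda j sv aff
    (fun q Dq => let: And5 h _ _ _ _ := base q Dq in h)
    (fun q Dq => let: And5 _ h _ _ _ := base q Dq in h)
    (fun q Dq => let: And5 _ _ h _ _ := base q Dq in h)
    (fun q Dq => let: And5 _ _ _ h _ := base q Dq in h)
    (fun q Dq => let: And5 _ _ _ _ h := base q Dq in h) sj Dj D0).
have {red} E ux uy uxx uyy uxy := red
  (jet_xyt p ux uy (- ((a - b * x) * ux + (d - e * y) * uy
     + x / 2 * uxx + y / 2 * uyy)) uxx uyy uxy 0 0) (is_jet_xyt _ _ _ _ _ _ _ _ _) Dp.
have D0 ux uy uxx uyy uxy : Delta_xyt a b d e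
    (jet_xyt p ux uy (- ((a - b * x) * ux + (d - e * y) * uy
     + x / 2 * uxx + y / 2 * uyy)) uxx uyy uxy 0 0) = 0.
  by rewrite /Delta_xyt /= -/x -/y; field.
have {D0} E ux uy uxx uyy uxy := E ux uy uxx uyy uxy (D0 _ _ _ _ _).
rewrite /= -/x -/y -/xi -/gam -/tau -/phi in E.
(* The normal form is affine in these five coordinates, so its values at the origin and at the unit
   vectors give all coefficients. *)
have E0 := E 0 0 0 0 0; have E1 := E 1 0 0 0 0; have E2 := E 0 1 0 0 0.
have E3 := E 0 0 1 0 0; have E4 := E 0 0 0 1 0; have E5 := E 0 0 0 0 1.
split; [exact: base|lra|lra|lra|] => u1.
have pE : upd p None 1 = p by rewrite -{2}(upd_same p None) u1.
rewrite !pE u1 in E0 E1 E2; split; lra.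
Qed.

(** * Partial derivatives along coordinate lines of the quadrant *)

Definition point_xyt (x y t u : R) : point 3 := fun k =>
  match k with
  | None => u
  | Some i => if i == iX then x else if i == iY then y else t
  end.

Lemma point_xytE p :
  p = point_xyt (p (Some iX)) (p (Some iY)) (p (Some iT)) (p None).
Proof.
apply: functional_extensionality; case=> [i|] //=.
by case: (ord3P i) => ->.
Qed.

Lemma upd_x x y t u s : upd (point_xyt x y t u) (Some iX) s = point_xyt s y t u.
Proof.
apply: functional_extensionality; case=> [i|] //=.
by rewrite /upd; case: (ord3P i) => ->.
Qed.

Lemma upd_y x y t u s : upd (point_xyt x y t u) (Some iY) s = point_xyt x s t u.
Proof.
apply: functional_extensionality; case=> [i|] //=.
by rewrite /upd; case: (ord3P i) => ->.
Qed.

Lemma upd_t x y t u s : upd (point_xyt x y t u) (Some iT) s = point_xyt x y s u.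
Proof.
apply: functional_extensionality; case=> [i|] //=.
by rewrite /upd; case: (ord3P i) => ->.
Qed.

Lemma upd_u x y t u s : upd (point_xyt x y t u) None s = point_xyt x y t s.
Proof. by apply: functional_extensionality; case. Qed.

Lemma locally_pos x : 0 < x -> locally x (fun s => 0 < s).
Proof. exact: open_gt. Qed.

Section PartialsXYT.
Variable f : point 3 -> R.

Lemma dx_val x y t u g l : 0 < x -> (forall s, 0 < s -> f (point_xyt s y t u) = g s) ->
  is_derive g x l -> dx f (point_xyt x y t u) = l.
Proof.
move=> x0 fg dg; apply: is_derive_unique.
apply: (is_derive_ext_loc g) => //; apply: filter_imp (locally_pos x0) => s s0.
by rewrite upd_x fg.
Qed.

Lemma dy_val x y t u g l : 0 < y -> (forall s, 0 < s -> f (point_xyt x s t u) = g s) ->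
  is_derive g y l -> dy f (point_xyt x y t u) = l.
Proof.
move=> y0 fg dg; apply: is_derive_unique.
apply: (is_derive_ext_loc g) => //; apply: filter_imp (locally_pos y0) => s s0.
by rewrite upd_y fg.
Qed.

Lemma dt_val x y t u g l : (forall s, f (point_xyt x y s u) = g s) ->
  is_derive g t l -> dt f (point_xyt x y t u) = l.
Proof.
move=> fg dg; apply: is_derive_unique.
by apply: (is_derive_extR g) => // s; rewrite upd_t fg.
Qed.

Hypothesis sf : smooth_on quadrant f.

Lemma is_derive_x x y t u : 0 < x -> 0 < y ->
  is_derive (fun s => f (point_xyt s y t u)) x (dx f (point_xyt x y t u)).
Proof.
move=> x0 y0; have D : quadrant (point_xyt x y t u) by [].
by apply: is_derive_extR (is_derive_partial (Some iX) sf D) => s; rewrite upd_x.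
Qed.

Lemma is_derive_y x y t u : 0 < x -> 0 < y ->
  is_derive (fun s => f (point_xyt x s t u)) y (dy f (point_xyt x y t u)).
Proof.
move=> x0 y0; have D : quadrant (point_xyt x y t u) by [].
by apply: is_derive_extR (is_derive_partial (Some iY) sf D) => s; rewrite upd_y.
Qed.

Lemma is_derive_xyt_t x y t u : 0 < x -> 0 < y ->
  is_derive (fun s => f (point_xyt x y s u)) t (dt f (point_xyt x y t u)).
Proof.
move=> x0 y0; have D : quadrant (point_xyt x y t u) by [].
by apply: is_derive_extR (is_derive_partial (Some iT) sf D) => s; rewrite upd_t.
Qed.

Lemma is_derive_u x y t u : 0 < x -> 0 < y ->
  is_derive (fun s => f (point_xyt x y t s)) u (du f (point_xyt x y t u)).
Proof.
move=> x0 y0; have D : quadrant (point_xyt x y t u) by [].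
by apply: is_derive_extR (is_derive_partial None sf D) => s; rewrite upd_u.
Qed.

End PartialsXYT.

(** * Dependence of tau, xi and gam on x and y *)

(** Packages a smooth function of [t] with all its derivatives, so that [T'], [T''] and so on can be
    handed over as [T 1], [T 2] without returning to partial derivatives. *)
Definition derivatives (F : nat -> R -> R) : Prop :=
  forall k t, is_derive (F k) t (F k.+1 t).

Lemma derivatives_t f x y u : smooth_on quadrant f -> 0 < x -> 0 < y ->
  derivatives (fun k t => iter k dt f (point_xyt x y t u)).
Proof.
move=> sf x0 y0 k t; rewrite iterS; apply: is_derive_xyt_t => //.
by elim: k => //= k; apply: smooth_on_partial.
Qed.

(** [c x] is a particular solution and [sqrt x] spans the solutions of the homogeneous equation, so
    [(f x - c x) / sqrt x] has derivative zero; its value is read at [x = 1]. *)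
Lemma sqrt_homogeneous (f f' : R -> R) c :
  (forall x, 0 < x -> is_derive f x (f' x)) ->
  (forall x, 0 < x -> 2 * x * f' x = f x + x * c) ->
  forall x, 0 < x -> f x = c * x + sqrt x * (f 1 - c).
Proof.
move=> df ode x x0.
suff : (f x - c * x) / sqrt x = (f 1 - c * 1) / sqrt 1.
  rewrite sqrt_1 => E; have s0 := sqrt_lt_R0 _ x0.
  have -> : f 1 - c = (f x - c * x) / sqrt x by rewrite E; field.
  by field; lra.
apply: (is_derive_zero_const_pos (f := fun s => (f s - c * s) / sqrt s)) Rlt_0_1 => //.
move=> s s0; have S0 := sqrt_lt_R0 _ s0; have SS := sqrt_sqrt _ (Rlt_le _ _ s0).
have := ode s s0; have {}df := df s s0 => E.
auto_derive; first by split; [exists (f' s)|split=> //; lra].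
rewrite (is_derive_unique _ _ _ df).
move: (f s) (f' s) (sqrt s) E S0 SS => F F' r E r0 rr.
have {E} -> : F = 2 * s * F' - s * c by lra.
by rewrite -rr; field; lra.
Qed.

Lemma sqrt_primitive (f f' : R -> R) c :
  (forall x, 0 < x -> is_derive f x (f' x)) ->
  (forall x, 0 < x -> f' x * sqrt x = c) ->
  forall x, 0 < x -> f x = f 1 + 2 * c * (sqrt x - 1).
Proof.
move=> df ode x x0.
suff : f x - 2 * c * sqrt x = f 1 - 2 * c * sqrt 1 by rewrite sqrt_1; lra.
apply: (is_derive_zero_const_pos (f := fun s => f s - 2 * c * sqrt s)) Rlt_0_1 => //.
move=> s s0; have S0 := sqrt_lt_R0 _ s0; have {}df := df s s0.
auto_derive; first by split; [exists (f' s)|].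
by rewrite (is_derive_unique _ _ _ df) -(ode s s0); field; lra.
Qed.

Lemma is_derive_affine (f : R -> R) k c d x l : is_derive f x l ->
  is_derive (fun s => k + c * (f s - d)) x (c * l).
Proof.
move=> df; auto_derive; first by exists l.
by rewrite (is_derive_unique _ _ _ df); ring.
Qed.

(** The equations for [xi_x] and [gam_y] leave only [xi] on [x = 1] and [gam] on [y = 1] unknown. On
    these lines the cross equation [x gam_x + y xi_y = 0] separates: the derivatives there are
    multiples of [y^(-1/2)] and [x^(-1/2)] with opposite factors depending on [t]. *)
Lemma xyt_shape xi gam tau :
  smooth_on quadrant xi -> smooth_on quadrant gam -> smooth_on quadrant tau ->
  (forall p, quadrant p ->
    let x := p (Some iX) in let y := p (Some iY) in
    [/\ [/\ du xi p = 0, du gam p = 0, du tau p = 0, dx tau p = 0 & dy tau p = 0],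
      x * dx gam p + y * dy xi p = 0,
      2 * x * dx xi p = xi p + x * dt tau p &
      2 * y * dy gam p = gam p + y * dt tau p]) ->
  exists T A B C : nat -> R -> R,
  [/\ derivatives T, derivatives A, derivatives B, derivatives C &
   forall x y t u, 0 < x -> 0 < y ->
   [/\ tau (point_xyt x y t u) = T 0%N t,
      xi (point_xyt x y t u) = T 1%N t * x + sqrt x * (A 0%N t - 2 * C 0%N t * sqrt y) &
      gam (point_xyt x y t u) = T 1%N t * y + sqrt y * (B 0%N t + 2 * C 0%N t * sqrt x)]].
Proof.
move=> sx sg st H.
pose P t := point_xyt 1 1 t 0.
pose T k t := iter k dt tau (P t).
(* Normalization at [x = y = 1]: there [xi_y = - C], [xi = T' + A - 2 C] and
   [gam = T' + B + 2 C]. *)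
pose C k t := - iter k dt (dy xi) (P t).
pose A k t := iter k dt xi (P t) - T k.+1 t + 2 * C k t.
pose B k t := iter k dt gam (P t) - T k.+1 t - 2 * C k t.
have dT : derivatives T by apply: derivatives_t => //; lra.
have dC : derivatives C.
  move=> k t; apply: is_derive_opp; apply: derivatives_t; try lra.
  exact: smooth_on_partial.
have dA : derivatives A.
  move=> k t; apply: is_derive_plus; last exact: is_derive_scal.
  by apply: is_derive_minus => //; apply: derivatives_t => //; lra.
have dB : derivatives B.
  move=> k t; apply: is_derive_minus; last exact: is_derive_scal.
  by apply: is_derive_minus => //; apply: derivatives_t => //; lra.
exists T, A, B, C; split=> //.
have H' x y t u (x0 : 0 < x) (y0 : 0 < y) := H (point_xyt x y t u) (conj x0 y0).
rewrite /= in H'.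
have tauE x y t u : 0 < x -> 0 < y -> tau (point_xyt x y t u) = T 0%N t.
  move=> x0 y0.
  rewrite (is_derive_zero_const_pos (f := fun s => tau (point_xyt s y t u))
    (y := 1) _ x0 Rlt_0_1); last first.
    move=> s s0; apply: is_derive_eq (is_derive_x st _ _ s0 y0) _.
    by have [[]] := H' s y t u s0 y0.
  rewrite (is_derive_zero_const_pos (f := fun s => tau (point_xyt 1 s t u))
    (y := 1) _ y0 Rlt_0_1); last first.
    move=> s s0; apply: is_derive_eq (is_derive_y st _ _ Rlt_0_1 s0) _.
    by have [[]] := H' 1 s t u Rlt_0_1 s0.
  apply: (is_derive_zero_constR (f := fun s => tau (point_xyt 1 1 t s)) _ u 0).
  move=> s; apply: is_derive_eq (is_derive_u st _ _ Rlt_0_1 Rlt_0_1) _.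
  by have [[]] := H' 1 1 t s Rlt_0_1 Rlt_0_1.
have tau_tE x y t u : 0 < x -> 0 < y -> dt tau (point_xyt x y t u) = T 1%N t.
  by move=> x0 y0; apply: (dt_val (g := T 0%N)) => // s; apply: tauE.
have uE f (sf : smooth_on quadrant f) : (forall p, quadrant p -> du f p = 0) ->
    forall x y t u, 0 < x -> 0 < y -> f (point_xyt x y t u) = f (point_xyt x y t 0).
  move=> f0 x y t u x0 y0.
  apply: (is_derive_zero_constR (f := fun s => f (point_xyt x y t s)) _ u 0).
  by move=> s; apply: is_derive_eq (is_derive_u sf _ _ x0 y0) (f0 _ _).
have xi_u := uE xi sx (fun p Dp => let: And4 (And5 h _ _ _ _) _ _ _ := H p Dp in h).
have gam_u := uE gam sg (fun p Dp => let: And4 (And5 _ h _ _ _) _ _ _ := H p Dp in h).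
have xiE x y t : 0 < x -> 0 < y ->
  xi (point_xyt x y t 0) = T 1%N t * x + sqrt x * (xi (point_xyt 1 y t 0) - T 1%N t).
  move=> x0 y0; apply: (sqrt_homogeneous (f := fun s => xi (point_xyt s y t 0))) x0.
    by move=> s s0; apply: is_derive_x.
  by move=> s s0; have [_ _] := H' s y t 0 s0 y0; rewrite tau_tE.
have gamE x y t : 0 < x -> 0 < y ->
  gam (point_xyt x y t 0) = T 1%N t * y + sqrt y * (gam (point_xyt x 1 t 0) - T 1%N t).
  move=> x0 y0; apply: (sqrt_homogeneous (f := fun s => gam (point_xyt x s t 0))) y0.
    by move=> s s0; apply: is_derive_y.
  by move=> s s0; have [_ _ _] := H' x s t 0 x0 s0; rewrite tau_tE.
have xi_yE x y t : 0 < x -> 0 < y ->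
  dy xi (point_xyt x y t 0) = sqrt x * dy xi (point_xyt 1 y t 0).
  move=> x0 y0; apply: (dy_val (g := fun s =>
     T 1%N t * x + sqrt x * (xi (point_xyt 1 s t 0) - T 1%N t))) => //.
    by move=> s s0; apply: xiE.
  have d := is_derive_y sx t 0 Rlt_0_1 y0.
  exact: (is_derive_affine _ _ _ d).
have gam_xE x y t : 0 < x -> 0 < y ->
  dx gam (point_xyt x y t 0) = sqrt y * dx gam (point_xyt x 1 t 0).
  move=> x0 y0; apply: (dx_val (g := fun s =>
     T 1%N t * y + sqrt y * (gam (point_xyt s 1 t 0) - T 1%N t))) => //.
    by move=> s s0; apply: gamE.
  have d := is_derive_x sg t 0 x0 Rlt_0_1.
  exact: (is_derive_affine _ _ _ d).
have gam_x1 x t : 0 < x -> dx gam (point_xyt x 1 t 0) * sqrt x = C 0%N t.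
  move=> x0; have [_ E _ _] := H' x 1 t 0 x0 Rlt_0_1.
  have S0 := sqrt_lt_R0 _ x0; have SS := sqrt_sqrt _ (Rlt_le _ _ x0).
  apply: (Rmult_eq_reg_l (sqrt x)); last lra.
  move: E; rewrite xi_yE //; try lra.
  by rewrite /C /= -/(P t) -{1}SS; lra.
have xi_y1 y t : 0 < y -> dy xi (point_xyt 1 y t 0) * sqrt y = - C 0%N t.
  move=> y0; have [_ E _ _] := H' 1 y t 0 Rlt_0_1 y0.
  have S0 := sqrt_lt_R0 _ y0; have SS := sqrt_sqrt _ (Rlt_le _ _ y0).
  have G := gam_x1 1 t Rlt_0_1; rewrite sqrt_1 Rmult_1_r in G.
  apply: (Rmult_eq_reg_l (sqrt y)); last lra.
  move: E; rewrite gam_xE // ?G; try lra.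
  by rewrite -{2}SS; lra.
move=> x y t u x0 y0; split; first exact: tauE.
  rewrite xi_u // xiE //; congr (_ + _ * _).
  rewrite (sqrt_primitive (f := fun s => xi (point_xyt 1 s t 0))
    (f' := fun s => dy xi (point_xyt 1 s t 0))
    (c := - C 0%N t) _ _ y0).
  - by rewrite /A /= -/(P t); ring.
  - by move=> s s0; apply: is_derive_y => //; lra.
  - by move=> s s0; apply: xi_y1.
rewrite gam_u // gamE //; congr (_ + _ * _).
rewrite (sqrt_primitive (f := fun s => gam (point_xyt s 1 t 0))
    (f' := fun s => dx gam (point_xyt s 1 t 0))
    (c := C 0%N t) _ _ x0).
- by rewrite /B /= -/(P t); ring.
- by move=> s s0; apply: is_derive_x => //; lra.
- by move=> s s0; apply: gam_x1.
Qed.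

(** With [x = r * r] and [sqrt x = r], identities containing square roots become rational and
    accessible to [field]. *)
Lemma pos_square x : 0 < x -> exists2 r, 0 < r & x = r * r.
Proof.
move=> x0; exists (sqrt x); first exact: sqrt_lt_R0.
by rewrite sqrt_sqrt; lra.
Qed.

(** * Equations for the functions of t *)

Section ShapedSymmetry.
Variables (a b : R) (xi gam tau phi : point 3 -> R).
Variables T0 T1 T2 T3 A A1 A2 B B1 B2 C C1 C2 : R -> R.
Hypothesis sphi : smooth_on quadrant phi.
Hypothesis dT1 : forall t, is_derive T1 t (T2 t).
Hypothesis dT2 : forall t, is_derive T2 t (T3 t).
Hypothesis dA : forall t, is_derive A t (A1 t).
Hypothesis dA1 : forall t, is_derive A1 t (A2 t).
Hypothesis dB : forall t, is_derive B t (B1 t).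
Hypothesis dB1 : forall t, is_derive B1 t (B2 t).
Hypothesis dC : forall t, is_derive C t (C1 t).
Hypothesis dT0 : forall t, is_derive T0 t (T1 t).
Hypothesis tauE : forall x y t u, 0 < x -> 0 < y -> tau (point_xyt x y t u) = T0 t.
Hypothesis xiE : forall x y t u, 0 < x -> 0 < y ->
  xi (point_xyt x y t u) = T1 t * x + sqrt x * (A t - 2 * C t * sqrt y).
Hypothesis gamE : forall x y t u, 0 < x -> 0 < y ->
  gam (point_xyt x y t u) = T1 t * y + sqrt y * (B t + 2 * C t * sqrt x).
Hypothesis eqs : forall p, quadrant p -> p None = 1 ->
  let x := p (Some iX) in let y := p (Some iY) in
  [/\ x * dx phi p = b * xi p
        + ((a - b * x) * dx xi p + (1 / 4 - b * y) * dy xi p + dt xi p)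
        + (x / 2 * dx (dx xi) p + y / 2 * dy (dy xi) p) - dt tau p * (a - b * x),
      y * dy phi p = b * gam p
        + ((a - b * x) * dx gam p + (1 / 4 - b * y) * dy gam p + dt gam p)
        + (x / 2 * dx (dx gam) p + y / 2 * dy (dy gam) p) - dt tau p * (1 / 4 - b * y)
    & dt phi p + (a - b * x) * dx phi p + (1 / 4 - b * y) * dy phi p
      + x / 2 * dx (dx phi) p + y / 2 * dy (dy phi) p = 0].
Hypothesis a14 : a <> 1 / 4.
Hypothesis a34 : a <> 3 / 4.

Local Notation P x y t := (point_xyt x y t 1).

Let tau_t x y t : 0 < x -> 0 < y -> dt tau (P x y t) = T1 t.
Proof. by move=> x0 y0; apply: (dt_val (g := T0)) => // s; apply: tauE. Qed.

Let xi_x x y t : 0 < x -> 0 < y ->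
  dx xi (P x y t) = T1 t + (A t - 2 * C t * sqrt y) / (2 * sqrt x).
Proof.
move=> x0 y0; have S0 := sqrt_lt_R0 _ x0.
apply: (dx_val x0 (fun s s0 => xiE _ _ s0 y0)).
by auto_derive=> //; field; lra.
Qed.

Let xi_xx x y t : 0 < x -> 0 < y ->
  dx (dx xi) (P x y t) = - (A t - 2 * C t * sqrt y) / (4 * (sqrt x * x)).
Proof.
move=> x0 y0; have S0 := sqrt_lt_R0 _ x0.
apply: (dx_val x0 (fun s s0 => xi_x _ s0 y0)).
auto_derive; first by repeat split; lra.
have [r r0 xr] := pos_square x0; subst x; rewrite sqrt_square in S0 *; last lra.
by field; lra.
Qed.

Let xi_y x y t : 0 < x -> 0 < y -> dy xi (P x y t) = - C t * sqrt x / sqrt y.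
Proof.
move=> x0 y0; have S0 := sqrt_lt_R0 _ y0.
apply: (dy_val y0 (fun s s0 => xiE _ _ x0 s0)).
by auto_derive=> //; field; lra.
Qed.

Let xi_yy x y t : 0 < x -> 0 < y ->
  dy (dy xi) (P x y t) = C t * sqrt x / (2 * (sqrt y * y)).
Proof.
move=> x0 y0; have S0 := sqrt_lt_R0 _ y0.
apply: (dy_val y0 (fun s s0 => xi_y _ x0 s0)).
auto_derive; first by repeat split; lra.
have [r r0 yr] := pos_square y0; subst y; rewrite sqrt_square in S0 *; last lra.
by field; lra.
Qed.

Let xi_t x y t : 0 < x -> 0 < y ->
  dt xi (P x y t) = T2 t * x + sqrt x * (A1 t - 2 * C1 t * sqrt y).
Proof.
move=> x0 y0; apply: (dt_val (fun s => xiE s _ x0 y0)).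
auto_derive; first by repeat split; eexists; eauto.
by rewrite (is_derive_unique _ _ _ (dT1 t)) (is_derive_unique _ _ _ (dA t))
  (is_derive_unique _ _ _ (dC t)); ring.
Qed.

Let gam_y x y t : 0 < x -> 0 < y ->
  dy gam (P x y t) = T1 t + (B t + 2 * C t * sqrt x) / (2 * sqrt y).
Proof.
move=> x0 y0; have S0 := sqrt_lt_R0 _ y0.
apply: (dy_val y0 (fun s s0 => gamE _ _ x0 s0)).
by auto_derive=> //; field; lra.
Qed.

Let gam_yy x y t : 0 < x -> 0 < y ->
  dy (dy gam) (P x y t) = - (B t + 2 * C t * sqrt x) / (4 * (sqrt y * y)).
Proof.
move=> x0 y0; have S0 := sqrt_lt_R0 _ y0.
apply: (dy_val y0 (fun s s0 => gam_y _ x0 s0)).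
auto_derive; first by repeat split; lra.
have [r r0 yr] := pos_square y0; subst y; rewrite sqrt_square in S0 *; last lra.
by field; lra.
Qed.

Let gam_x x y t : 0 < x -> 0 < y -> dx gam (P x y t) = C t * sqrt y / sqrt x.
Proof.
move=> x0 y0; have S0 := sqrt_lt_R0 _ x0.
apply: (dx_val x0 (fun s s0 => gamE _ _ s0 y0)).
by auto_derive=> //; field; lra.
Qed.

Let gam_xx x y t : 0 < x -> 0 < y ->
  dx (dx gam) (P x y t) = - C t * sqrt y / (2 * (sqrt x * x)).
Proof.
move=> x0 y0; have S0 := sqrt_lt_R0 _ x0.
apply: (dx_val x0 (fun s s0 => gam_x _ s0 y0)).
auto_derive; first by repeat split; lra.
have [r r0 xr] := pos_square x0; subst x; rewrite sqrt_square in S0 *; last lra.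
by field; lra.
Qed.

Let gam_t x y t : 0 < x -> 0 < y ->
  dt gam (P x y t) = T2 t * y + sqrt y * (B1 t + 2 * C1 t * sqrt x).
Proof.
move=> x0 y0; apply: (dt_val (fun s => gamE s _ x0 y0)).
auto_derive; first by repeat split; eexists; eauto.
by rewrite (is_derive_unique _ _ _ (dT1 t)) (is_derive_unique _ _ _ (dB t))
  (is_derive_unique _ _ _ (dC t)); ring.
Qed.

(** The factor [a / 2 - 1 / 8] comes from [a xi_x + (x/2) xi_xx]. Since [d = 1/4], the terms
    [(1/4) xi_y] and [(y/2) xi_yy] cancel, and [- b y xi_y] compensates the part of
    [b xi - b x xi_x] containing [C]. *)
Let phi_x x y t : 0 < x -> 0 < y -> dx phi (P x y t) = T2 t + b * T1 t
  + (b * A t / 2 + A1 t - 2 * C1 t * sqrt y) / sqrt x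
  + (a / 2 - 1 / 8) * (A t - 2 * C t * sqrt y) / (sqrt x * x).
Proof.
move=> x0 y0; apply: (Rmult_eq_reg_l x); last lra.
have [/= -> _ _] := @eqs (P x y t) (conj x0 y0) erefl.
rewrite xiE // xi_x // xi_y // xi_t // xi_xx // xi_yy // tau_t //.
have [r r0 xr] := pos_square x0; have [q q0 yq] := pos_square y0; subst x y.
by rewrite !sqrt_square; [field|lra|lra]; lra.
Qed.

Let phi_y x y t : 0 < x -> 0 < y -> dy phi (P x y t) = T2 t + b * T1 t
  + (b * B t / 2 + B1 t + 2 * C1 t * sqrt x + (a - 1 / 4) * C t / sqrt x) / sqrt y.
Proof.
move=> x0 y0; apply: (Rmult_eq_reg_l y); last lra.
have [/= _ -> _] := @eqs (P x y t) (conj x0 y0) erefl.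
rewrite gamE // gam_x // gam_y // gam_t // gam_xx // gam_yy // tau_t //.
have [r r0 xr] := pos_square x0; have [q q0 yq] := pos_square y0; subst x y.
by rewrite !sqrt_square; [field|lra|lra]; lra.
Qed.

(** Integration of [phi_x] from [x = 1] with [y] and [t] as parameters; [G] is the primitive
    vanishing at [x = 1]. *)
Let phi_diff_x x y t : 0 < x -> 0 < y -> phi (P x y t) - phi (P 1 y t) =
  (T2 t + b * T1 t) * (x - 1)
  + (b * A t + 2 * A1 t - 4 * C1 t * sqrt y) * (sqrt x - 1)
  - (a - 1 / 4) * (A t - 2 * C t * sqrt y) * (/ sqrt x - 1).
Proof.
move=> x0 y0.
set G := fun s => (T2 t + b * T1 t) * (s - 1)
  + (b * A t + 2 * A1 t - 4 * C1 t * sqrt y) * (sqrt s - 1)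
  - (a - 1 / 4) * (A t - 2 * C t * sqrt y) * (/ sqrt s - 1).
have G1 : G 1 = 0 by rewrite /G sqrt_1; field.
suff : phi (P x y t) - G x = phi (P 1 y t) - G 1 by rewrite G1 -/(G x); lra.
apply: (is_derive_zero_const_pos (f := fun s => phi (P s y t) - G s)) x0 Rlt_0_1.
move=> s s0; apply: (is_derive_eq
  (is_derive_minus _ _ _ _ _ (is_derive_x sphi t 1 s0 y0) (_ : is_derive G s
   (dx phi (P s y t))))); last by rewrite /minus /plus /opp /=; ring.
have S0 := sqrt_lt_R0 _ s0.
rewrite phi_x // /G; auto_derive; first by repeat split; lra.
have [r r0 sr] := pos_square s0; subst s; rewrite sqrt_square in S0 *; last lra.
by field; lra.
Qed.

(* The mixed second derivatives of [phi] agree, tested between x = 1 and x = 4. *)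
Let C1_0 t : C1 t = 0.
Proof.
have p4 : 0 < 4 by lra. have p1 := Rlt_0_1.
have s4 : sqrt 4 = 2 by rewrite (_ : 4 = 2 * 2) ?sqrt_square; lra.
have d1 := is_derive_minus _ _ _ _ _ (is_derive_y sphi t 1 p4 p1)
  (is_derive_y sphi t 1 p1 p1).
have d2 : is_derive (fun y => phi (P 4 y t) - phi (P 1 y t)) 1
    (- 2 * C1 t - (a - 1 / 4) * C t / 2).
  apply: (is_derive_ext_loc (fun y => (T2 t + b * T1 t) * (4 - 1)
    + (b * A t + 2 * A1 t - 4 * C1 t * sqrt y) * (2 - 1)
    - (a - 1 / 4) * (A t - 2 * C t * sqrt y) * (/ 2 - 1))).
    by apply: filter_imp (locally_pos p1) => y y0; rewrite phi_diff_x // s4.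
  by auto_derive=> //; rewrite sqrt_1; field.
(* Both values contain [- (a - 1/4) C / 2], but [C1] enters one as [2 C1] and the other as
   [- 2 C1]. *)
have := etrans (esym (is_derive_unique _ _ _ d1)) (is_derive_unique _ _ _ d2).
by rewrite /minus /plus /opp /= !phi_y // s4 sqrt_1; lra.
Qed.

Let l0 t := phi (P 1 1 t).
Let l1 t := dt phi (P 1 1 t).

Let phi_diff_y y t : 0 < y -> phi (P 1 y t) = l0 t + (T2 t + b * T1 t) * (y - 1)
  + (b * B t + 2 * B1 t + 2 * (a - 1 / 4) * C t) * (sqrt y - 1).
Proof.
move=> y0; have p1 := Rlt_0_1.
set G := fun s => (T2 t + b * T1 t) * (s - 1)
  + (b * B t + 2 * B1 t + 2 * (a - 1 / 4) * C t) * (sqrt s - 1).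
have G1 : G 1 = 0 by rewrite /G sqrt_1; field.
suff : phi (P 1 y t) - G y = phi (P 1 1 t) - G 1.
  by rewrite G1 /l0; rewrite /G; lra.
apply: (is_derive_zero_const_pos (f := fun s => phi (P 1 s t) - G s)) y0 Rlt_0_1.
move=> s s0; apply: (is_derive_eq
  (is_derive_minus _ _ _ _ _ (is_derive_y sphi t 1 p1 s0) (_ : is_derive G s
   (dy phi (P 1 s t))))); last by rewrite /minus /plus /opp /=; ring.
have S0 := sqrt_lt_R0 _ s0.
rewrite phi_y // C1_0 sqrt_1 /G; auto_derive; first by repeat split; lra.
by field; lra.
Qed.

Let phiE x y t : 0 < x -> 0 < y -> phi (P x y t) =
  l0 t + (T2 t + b * T1 t) * (x + y - 2)
  + (b * A t + 2 * A1 t) * (sqrt x - 1)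
  - (a - 1 / 4) * (A t - 2 * C t * sqrt y) * (/ sqrt x - 1)
  + (b * B t + 2 * B1 t + 2 * (a - 1 / 4) * C t) * (sqrt y - 1).
Proof.
by move=> x0 y0; have := phi_diff_x t x0 y0; rewrite phi_diff_y // C1_0; lra.
Qed.

Let phi_t x y t : 0 < x -> 0 < y -> dt phi (P x y t) =
  l1 t + (T3 t + b * T2 t) * (x + y - 2)
  + (b * A1 t + 2 * A2 t) * (sqrt x - 1)
  - (a - 1 / 4) * A1 t * (/ sqrt x - 1)
  + (b * B1 t + 2 * B2 t) * (sqrt y - 1).
Proof.
move=> x0 y0; apply: (dt_val (fun s => phiE s x0 y0)).
have p1 := Rlt_0_1.
have dl : is_derive l0 t (l1 t) by apply: is_derive_xyt_t.
auto_derive; first by repeat split; eexists; eauto.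
rewrite (is_derive_unique _ _ _ (dT1 t)) (is_derive_unique _ _ _ (dA t))
  (is_derive_unique _ _ _ (dC t)) (is_derive_unique _ _ _ (dT2 t))
  (is_derive_unique _ _ _ (dA1 t)) (is_derive_unique _ _ _ (dB t))
  (is_derive_unique _ _ _ (dB1 t)) (is_derive_unique _ _ _ dl) C1_0; ring.
Qed.

Let phi_xx x y t : 0 < x -> 0 < y -> dx (dx phi) (P x y t) =
  - (b * A t / 2 + A1 t) / (2 * (sqrt x * x))
  - 3 / 2 * (a / 2 - 1 / 8) * (A t - 2 * C t * sqrt y) / (sqrt x * x * x).
Proof.
move=> x0 y0; have S0 := sqrt_lt_R0 _ x0.
apply: (dx_val x0 (fun s s0 => phi_x t s0 y0)).
have N0 : sqrt x * x <> 0 by apply: Rmult_integral_contrapositive; lra.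
auto_derive; first by repeat split; lra.
have [r r0 xr] := pos_square x0; subst x; rewrite sqrt_square in S0 N0 *; last lra.
by rewrite C1_0; field; lra.
Qed.

Let phi_yy x y t : 0 < x -> 0 < y -> dy (dy phi) (P x y t) =
  - (b * B t / 2 + B1 t + (a - 1 / 4) * C t / sqrt x) / (2 * (sqrt y * y)).
Proof.
move=> x0 y0; have S0 := sqrt_lt_R0 _ y0; have S1 := sqrt_lt_R0 _ x0.
apply: (dy_val y0 (fun s s0 => phi_y t x0 s0)).
auto_derive; first by repeat split; lra.
have [r r0 yr] := pos_square y0; subst y; rewrite sqrt_square in S0 *; last lra.
by rewrite C1_0; field; lra.
Qed.

(* The zeroth-order equation at x = r^2, y = q^2. *)
Let zeroth_order r q t : 0 < r -> 0 < q ->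
  l1 t + (T3 t + b * T2 t) * (r * r + q * q - 2)
  + (b * A1 t + 2 * A2 t) * (r - 1) - (a - 1 / 4) * A1 t * (/ r - 1)
  + (b * B1 t + 2 * B2 t) * (q - 1)
  + (a - b * (r * r)) * (T2 t + b * T1 t + (b * A t / 2 + A1 t) / r)
  - b * (r * r) * (a / 2 - 1 / 8) * (A t - 2 * C t * q) / (r * r * r)
  + (a - 3 / 4) * (a / 2 - 1 / 8) * (A t - 2 * C t * q) / (r * r * r)
  - (b * A t / 2 + A1 t) / (4 * r)
  + (1 / 4 - b * (q * q)) * (T2 t + b * T1 t)
  - b * q * (b * B t / 2 + B1 t + (a - 1 / 4) * C t / r) = 0.
Proof.
move=> r0 q0; have x0 : 0 < r * r by nra.
have y0 : 0 < q * q by nra.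
have [_ _ /= <-] := @eqs (P (r * r) (q * q) t) (conj x0 y0) erefl.
rewrite phi_t // phi_x // phi_y // phi_xx // phi_yy // C1_0 !sqrt_square; try lra.
by field; lra.
Qed.

(* Times r^3, the zeroth-order equation is a polynomial in r of degree 5 without
   linear term, hence zero by its values at 1, ..., 5; its constant term is [K]. *)
Let AC0 t q : 0 < q -> A t - 2 * C t * q = 0.
Proof.
move=> q0.
pose K := (a - 3 / 4) * (a / 2 - 1 / 8) * (A t - 2 * C t * q).
have E r : 0 < r -> K
  + (- b * (a / 2 - 1 / 8) * (A t - 2 * C t * q) - (a - 1 / 4) * A1 t
     + a * (b * A t / 2 + A1 t) - (b * A t / 2 + A1 t) / 4
     - b * q * (a - 1 / 4) * C t) * r ^ 2
  + (l1 t + (T3 t + b * T2 t) * (q * q - 2) - (b * A1 t + 2 * A2 t)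
     + (a - 1 / 4) * A1 t + (b * B1 t + 2 * B2 t) * (q - 1)
     + a * (T2 t + b * T1 t) + (1 / 4 - b * (q * q)) * (T2 t + b * T1 t)
     - b * q * (b * B t / 2 + B1 t)) * r ^ 3
  + (b * A1 t + 2 * A2 t - b * (b * A t / 2 + A1 t)) * r ^ 4
  + (T3 t + b * T2 t - b * (T2 t + b * T1 t)) * r ^ 5 = 0.
  move=> r0; rewrite -(Rmult_0_r (r * r * r)) -(zeroth_order t r0 q0) /K; field; lra.
move: (E 1) (E 2) (E 3) (E 4) (E 5).
set c2 := (X in X * _ ^ 2); set c3 := (X in X * _ ^ 3).
set c4 := (X in X * _ ^ 4); set c5 := (X in X * _ ^ 5).
move=> E1 E2 E3 E4 E5.
have K0 : K = 0.
  by have := E1 ltac:(lra); have := E2 ltac:(lra); have := E3 ltac:(lra);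
     have := E4 ltac:(lra); have := E5 ltac:(lra); lra.
(* [a <> 3/4] and [a <> 1/4] exclude the first two factors. *)
move: K0; rewrite /K => /Rmult_integral[/Rmult_integral[]|]; lra.
Qed.

Lemma shape_A t : A t = 0.
Proof. by have := AC0 t Rlt_0_1; have := @AC0 t 2 ltac:(lra); lra. Qed.

Lemma shape_C t : C t = 0.
Proof. by have := AC0 t Rlt_0_1; have := @AC0 t 2 ltac:(lra); lra. Qed.

Let A1_0 t : A1 t = 0.
Proof.
rewrite -(is_derive_unique _ _ _ (dA t)) -[RHS](Derive_const 0 t).
by apply: Derive_ext; apply: shape_A.
Qed.

Let A2_0 t : A2 t = 0.
Proof.
rewrite -(is_derive_unique _ _ _ (dA1 t)) -[RHS](Derive_const 0 t).
by apply: Derive_ext; apply: A1_0.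
Qed.

Let E r q t : 0 < r -> 0 < q ->
  l1 t + (T3 t + b * T2 t) * (r * r + q * q - 2)
  + (b * B1 t + 2 * B2 t) * (q - 1)
  + (a - b * (r * r)) * (T2 t + b * T1 t)
  + (1 / 4 - b * (q * q)) * (T2 t + b * T1 t)
  - b * q * (b * B t / 2 + B1 t) = 0.
Proof.
move=> r0 q0; rewrite -(zeroth_order t r0 q0) !shape_A !shape_C !A1_0 !A2_0.
by field; lra.
Qed.

(** The difference between [r = 1] and [r = 2] isolates the coefficient of [r^2] in [E], in which
    [b T2] cancels. *)
Lemma shape_T t : T3 t = b ^ 2 * T1 t.
Proof.
have := @E 1 1 t ltac:(lra) ltac:(lra).
by have := @E 2 1 t ltac:(lra) ltac:(lra); lra.
Qed.

(** By [shape_T] the coefficient of [q^2] in [E] vanishes, so the difference between [q = 1] and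
    [q = 2] is the coefficient of [q], in which [b B1] cancels. *)
Lemma shape_B t : B2 t = (b / 2) ^ 2 * B t.
Proof.
have := @E 1 1 t ltac:(lra) ltac:(lra); have := @E 1 2 t ltac:(lra) ltac:(lra).
by rewrite shape_T; lra.
Qed.

(** [rho] gathers the terms of [phi] free of [x] and [y]; its derivative is prescribed by the
    constant term of the zeroth-order equation. *)
Lemma shape_phi : exists2 rho,
  forall t, is_derive rho t (- (a + 1 / 4) * (T2 t + b * T1 t)) &
  forall x y t, 0 < x -> 0 < y -> phi (P x y t) =
    (T2 t + b * T1 t) * (x + y) + (b * B t + 2 * B1 t) * sqrt y + rho t.
Proof.
exists (fun t => l0 t - 2 * (T2 t + b * T1 t) - (b * B t + 2 * B1 t)).
  move=> t; have dl : is_derive l0 t (l1 t).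
    by apply: is_derive_xyt_t => //; lra.
  auto_derive; first by repeat split; eexists; eauto.
  rewrite (is_derive_unique _ _ _ (dT1 t)) (is_derive_unique _ _ _ (dT2 t)).
  rewrite (is_derive_unique _ _ _ (dB t)) (is_derive_unique _ _ _ (dB1 t)).
  rewrite (is_derive_unique _ _ _ dl).
  have := @E 1 1 t ltac:(lra) ltac:(lra).
  by rewrite shape_T shape_B; lra.
move=> x y t x0 y0; rewrite phiE // !shape_A !shape_C !A1_0; ring.
Qed.

End ShapedSymmetry.

(** * The equation f'' = m^2 f *)

Lemma exp_mul_opp x : exp x * exp (- x) = 1.
Proof. by rewrite -exp_plus Rplus_opp_r exp_0. Qed.

(** For [s = m] and [s = - m] the function [g = f' + s f] satisfies [g' = s g], hence is a multiple
    of [exp (s t)]; [f] and [f'] are recovered from the two choices of [g]. *)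
Lemma ode_exponential m (f f1 : R -> R) : m <> 0 ->
  (forall t, is_derive f t (f1 t)) -> (forall t, is_derive f1 t (m ^ 2 * f t)) ->
  exists al be, forall t, f t = al * exp (m * t) + be * exp (- m * t) /\
    f1 t = m * (al * exp (m * t) - be * exp (- m * t)).
Proof.
move=> m0 df df1.
have cst s t (s2 : s ^ 2 = m ^ 2) :
    f1 t + s * f t = (f1 0 + s * f 0) * exp (s * t).
  have H : (f1 t + s * f t) * exp (- (s * t)) = (f1 0 + s * f 0) * exp (- (s * 0)).
    apply: (is_derive_zero_constR
      (f := fun t => (f1 t + s * f t) * exp (- (s * t)))) => r.
    auto_derive; first by repeat split; eexists; eauto.
    rewrite (is_derive_unique _ _ _ (df r)) (is_derive_unique _ _ _ (df1 r)) -s2.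
    by ring.
  have -> : f1 0 + s * f 0 = (f1 t + s * f t) * exp (- (s * t)).
    by rewrite H Rmult_0_r Ropp_0 exp_0; ring.
  by rewrite Rmult_assoc (Rmult_comm (exp _)) exp_mul_opp; ring.
exists ((f1 0 + m * f 0) / (2 * m)), ((m * f 0 - f1 0) / (2 * m)) => t.
have E1 := cst m t erefl; have E2 := cst (- m) t ltac:(ring).
have e1 : (f1 0 + m * f 0) * exp (m * t) = f1 t + m * f t by rewrite E1.
have e2 : (m * f 0 - f1 0) * exp (- m * t) = m * f t - f1 t.
  have -> : m * f 0 - f1 0 = - (f1 0 + - m * f 0) by ring.
  lra.
split.
  have -> : (f1 0 + m * f 0) / (2 * m) * exp (m * t)
     + (m * f 0 - f1 0) / (2 * m) * exp (- m * t)
     = ((f1 0 + m * f 0) * exp (m * t) + (m * f 0 - f1 0) * exp (- m * t)) / (2 * m).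
    by field.
  by rewrite e1 e2; field.
have -> : m * ((f1 0 + m * f 0) / (2 * m) * exp (m * t)
     - (m * f 0 - f1 0) / (2 * m) * exp (- m * t))
     = ((f1 0 + m * f 0) * exp (m * t) - (m * f 0 - f1 0) * exp (- m * t)) / 2.
  by field.
by rewrite e1 e2; field.
Qed.

(* [c1 v1 + ... + c6 v6]. *)
Definition symmetry_field (a b c1 c2 c3 c4 c5 c6 : R) : vfield 3 := vf3
  (fun x y t u => b * (c1 * exp (b * t) - c2 * exp (- b * t)) * x)
  (fun x y t u => b * (c1 * exp (b * t) - c2 * exp (- b * t)) * y
     + sqrt y * (c4 * exp (b / 2 * t) + c5 * exp (- b / 2 * t)))
  (fun x y t u => c1 * exp (b * t) + c2 * exp (- b * t) + c3)
  (fun x y t u => (2 * b * c1 * exp (b * t) * (b * (x + y) - (a + 1 / 4))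
     - b * (1 / 4 + a) * c3 + 2 * b * c4 * sqrt y * exp (b / 2 * t) + c6) * u).

(** * The symmetries are the combinations of v1, ..., v6 *)

Section SymmetryField.
Variables a b : R.
Hypothesis b0 : b <> 0.

Section Fixed.
Variables c1 c2 c3 c4 c5 c6 : R.
Local Notation F := (symmetry_field a b c1 c2 c3 c4 c5 c6).

Lemma symmetry_field_smooth k : smooth_on quadrant (F k).
Proof.
apply: elementary_smooth open_quadrant _; rewrite /symmetry_field /vf3.
case: k => [i|]; first case: (i == iX); try case: (i == iY); elementary_tac;
  by move=> p [].
Qed.

Lemma symmetry_field_affine :
  affine_in_u quadrant (F None) (fun z => 
     2 * b * c1 * exp (b * z iT) * (b * (z iX + z iY) - (a + 1 / 4))
     - b * (1 / 4 + a) * c3 + 2 * b * c4 * sqrt (z iY) * exp (b / 2 * z iT) + c6)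
    (fun=> 0).
Proof. by move=> p _; rewrite /symmetry_field /vf3; ring. Qed.

Section Point.
Variables x y t u : R.
Hypothesis x0 : 0 < x.
Hypothesis y0 : 0 < y.
Local Notation p := (point_xyt x y t u).

Lemma symmetry_field_partials :
  ((dx (F (Some iX)) p = b * (c1 * exp (b * t) - c2 * exp (- b * t)))%R *
  (dy (F (Some iX)) p = 0)%R *
  (dt (F (Some iX)) p = b ^ 2 * (c1 * exp (b * t) + c2 * exp (- b * t)) * x)%R *
  (du (F (Some iX)) p = 0)%R *
  (dx (F (Some iY)) p = 0)%R *
  (dy (F (Some iY)) p = b * (c1 * exp (b * t) - c2 * exp (- b * t))
     + (c4 * exp (b / 2 * t) + c5 * exp (- b / 2 * t)) / (2 * sqrt y))%R *
  (dt (F (Some iY)) p = b ^ 2 * (c1 * exp (b * t) + c2 * exp (- b * t)) * y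
     + sqrt y * (b / 2) * (c4 * exp (b / 2 * t) - c5 * exp (- b / 2 * t)))%R *
  (du (F (Some iY)) p = 0)%R *
  (dx (F (Some iT)) p = 0)%R *
  (dy (F (Some iT)) p = 0)%R *
  (dt (F (Some iT)) p = b * (c1 * exp (b * t) - c2 * exp (- b * t)))%R *
  (du (F (Some iT)) p = 0)%R *
  (dx (F None) p = 2 * b ^ 2 * c1 * exp (b * t) * u)%R *
  (dy (F None) p = (2 * b ^ 2 * c1 * exp (b * t)
     + b * c4 * exp (b / 2 * t) / sqrt y) * u)%R *
  (dt (F None) p = (2 * b ^ 2 * c1 * exp (b * t) * (b * (x + y) - (a + 1 / 4))
     + b ^ 2 * c4 * sqrt y * exp (b / 2 * t)) * u)%R *
  (du (F None) p = 2 * b * c1 * exp (b * t) * (b * (x + y) - (a + 1 / 4))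
     - b * (1 / 4 + a) * c3 + 2 * b * c4 * sqrt y * exp (b / 2 * t) + c6)%R)%type.
Proof.
have S0 := sqrt_lt_R0 _ y0.
repeat split;
 try (apply: (dx_val x0 (fun s s0 => erefl)) => /=; auto_derive => //; field; lra);
 try (apply: (dy_val y0 (fun s s0 => erefl)) => /=; auto_derive => //; field; lra);
 try (apply: (dt_val (fun s => erefl)) => /=; auto_derive => //; field; lra).
all: by apply: is_derive_unique; rewrite /symmetry_field /vf3 /upd /=;
  auto_derive=> //; field; lra.
Qed.

End Point.

Lemma symmetry_field_mem :
  is_linear_symmetry quadrant (Delta_xyt a b (1 / 4) b) F.
Proof.
split; last by eexists; apply: symmetry_field_affine.
have sF := symmetry_field_smooth; split=> // j sj Dj D0.
have H (k : option 'I_3) (l : option 'I_3) :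
    (forall x y t u, 0 < x -> 0 < y -> partial l (F k) (point_xyt x y t u) = 0) ->
    forall q, quadrant q -> partial l (F k) q = 0.
  by move=> H q [q1 q2]; rewrite (point_xytE q) H.
rewrite (pr2_xyt_reduced sF symmetry_field_affine) //; try by apply: H => *;
  rewrite symmetry_field_partials.
case: j Dj {sj D0} => p u1 u2 /=; rewrite (point_xytE p) upd_u /=.
move: (p (Some iX)) (p (Some iY)) (p (Some iT)) (p None) => x y t u [/= x0 y0].
have S0 := sqrt_lt_R0 _ y0; have [r r0 yr] := pos_square y0.
(* First derivatives are given by formulas at points of the quadrant only. A second derivative is
   therefore computed along a coordinate line inside the quadrant. *)
have second k l g l' z : (l = iX /\ z = x /\ (forall s, 0 < s ->
      partial (Some l) (F k) (point_xyt s y t l') = g s) \/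
    l = iY /\ z = y /\ (forall s, 0 < s ->
      partial (Some l) (F k) (point_xyt x s t l') = g s)) ->
    forall m, is_derive g z m ->
    partial (Some l) (partial (Some l) (F k)) (point_xyt x y t l') = m.
  by move=> [[-> [-> e]]|[-> [-> e]]] m dg; [apply: dx_val e dg|apply: dy_val e dg].
have xi_xx : dx (dx (F (Some iX))) (point_xyt x y t u) = 0.
  apply: (second _ _ (fun=> b * (c1 * exp (b * t) - c2 * exp (- b * t))) _ x).
    by left; do 2!split=> //; move=> s s0; rewrite symmetry_field_partials.
  exact: is_derive_const.
have xi_yy : dy (dy (F (Some iX))) (point_xyt x y t u) = 0.
  apply: (second _ _ (fun=> 0) _ y).
    by right; do 2!split=> //; move=> s s0; rewrite symmetry_field_partials.
  exact: is_derive_const.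
have gam_xx : dx (dx (F (Some iY))) (point_xyt x y t u) = 0.
  apply: (second _ _ (fun=> 0) _ x).
    by left; do 2!split=> //; move=> s s0; rewrite symmetry_field_partials.
  exact: is_derive_const.
have gam_yy : dy (dy (F (Some iY))) (point_xyt x y t u) =
    - (c4 * exp (b / 2 * t) + c5 * exp (- b / 2 * t)) / (4 * (sqrt y * y)).
  apply: (second _ _ (fun s => b * (c1 * exp (b * t) - c2 * exp (- b * t))
     + (c4 * exp (b / 2 * t) + c5 * exp (- b / 2 * t)) / (2 * sqrt s)) _ y).
    by right; do 2!split=> //; move=> s s0; rewrite symmetry_field_partials.
  auto_derive; first by repeat split; lra.
  by rewrite yr sqrt_square; [field|]; lra.
have phi_xx : dx (dx (F None)) (point_xyt x y t 1) = 0.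
  apply: (second _ _ (fun=> 2 * b ^ 2 * c1 * exp (b * t) * 1) _ x).
    by left; do 2!split=> //; move=> s s0; rewrite symmetry_field_partials.
  exact: is_derive_const.
have phi_yy : dy (dy (F None)) (point_xyt x y t 1) =
    - b * c4 * exp (b / 2 * t) / (2 * (sqrt y * y)).
  apply: (second _ _ (fun s => (2 * b ^ 2 * c1 * exp (b * t)
     + b * c4 * exp (b / 2 * t) / sqrt s) * 1) _ y).
    by right; do 2!split=> //; move=> s s0; rewrite symmetry_field_partials.
  auto_derive; first by repeat split; lra.
  by rewrite yr sqrt_square; [field|]; lra.
rewrite xi_xx xi_yy gam_xx gam_yy phi_xx phi_yy !symmetry_field_partials //.
rewrite /symmetry_field /vf3 /= yr sqrt_square; last lra.
by field; lra.
Qed.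

End Fixed.

Lemma symmetry_field_onto v : a <> 1 / 4 -> a <> 3 / 4 ->
  is_linear_symmetry quadrant (Delta_xyt a b (1 / 4) b) v ->
  exists c1 c2 c3 c4 c5 c6,
    vf_eq quadrant v (symmetry_field a b c1 c2 c3 c4 c5 c6).
Proof.
move=> a14 a34 [symv [lam aff]]; have [sv _] := symv.
have det := xyt_determining sv aff symv.
set xi := v (Some iX) in det; set gam := v (Some iY) in det.
set tau := v (Some iT) in det; set phi := v None in det.
have [T [A [B [C [dT dA dB dC shape]]]]] := @xyt_shape xi gam tau (sv _) (sv _) (sv _)
  (fun p Dp => let: And5 h1 h2 h3 h4 _ := det p Dp in And4 h1 h2 h3 h4).
have tauE x y t u x0 y0 := let: And3 h _ _ := shape x y t u x0 y0 in h.
have xiE x y t u x0 y0 := let: And3 _ h _ := shape x y t u x0 y0 in h.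
have gamE x y t u x0 y0 := let: And3 _ _ h := shape x y t u x0 y0 in h.
have eqs p (Dp : quadrant p) := let: And5 _ _ _ _ h := det p Dp in h.
have A0 := shape_A (sv None : smooth_on quadrant phi) (dT 1%N) (dT 2%N) (dA 0%N)
  (dA 1%N) (dB 0%N) (dB 1%N) (dC 0%N) (dT 0%N) tauE xiE gamE eqs a14 a34.
have C0 := shape_C (sv None : smooth_on quadrant phi) (dT 1%N) (dT 2%N) (dA 0%N)
  (dA 1%N) (dB 0%N) (dB 1%N) (dC 0%N) (dT 0%N) tauE xiE gamE eqs a14 a34.
have T3 := shape_T (sv None : smooth_on quadrant phi) (dT 1%N) (dT 2%N) (dA 0%N)
  (dA 1%N) (dB 0%N) (dB 1%N) (dC 0%N) (dT 0%N) tauE xiE gamE eqs a14 a34.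
have B2 := shape_B (sv None : smooth_on quadrant phi) (dT 1%N) (dT 2%N) (dA 0%N)
  (dA 1%N) (dB 0%N) (dB 1%N) (dC 0%N) (dT 0%N) tauE xiE gamE eqs a14 a34.
have [rho drho phiE] := shape_phi (sv None : smooth_on quadrant phi) (dT 1%N) (dT 2%N)
  (dA 0%N) (dA 1%N) (dB 0%N) (dB 1%N) (dC 0%N) (dT 0%N) tauE xiE gamE eqs a14 a34.
have [al [be T12]] : exists al be, forall t,
    T 1%N t = al * exp (b * t) + be * exp (- b * t) /\
    T 2%N t = b * (al * exp (b * t) - be * exp (- b * t)).
  by apply: ode_exponential => // t; rewrite -T3; apply: (dT 2%N).
have [mu [nu B01]] : exists mu nu, forall t,
    B 0%N t = mu * exp (b / 2 * t) + nu * exp (- (b / 2) * t) /\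
    B 1%N t = b / 2 * (mu * exp (b / 2 * t) - nu * exp (- (b / 2) * t)).
  by apply: ode_exponential => [|//|t]; [lra|rewrite -B2; apply: (dB 1%N)].
have bh : - (b / 2) = - b / 2 by field.
rewrite bh in B01.
(* [T'] is a primitive of [T 1]; the constant by which [tau] differs from it is the coefficient of
   [v3]. *)
pose T' t := al / b * exp (b * t) - be / b * exp (- b * t).
have TE t : T 0%N t = T' t + (T 0%N 0 - T' 0).
  suff : T 0%N t - T' t = T 0%N 0 - T' 0 by lra.
  apply: (is_derive_zero_constR (f := fun s => T 0%N s - T' s)) => s.
  apply: is_derive_eq (is_derive_minus _ _ _ _ (T 1%N s) (dT 0%N s) _) _.
    by rewrite (T12 s).1 /T'; auto_derive=> //; field.
  by rewrite /minus /plus /opp /=; ring.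
(* [T 2 + b T 1] equals [2 b al exp (b t)]: the parts in [exp (- b t)] cancel, which is why [v2] has
   no [u]-component. *)
pose rho' t := - (a + 1 / 4) * (2 * al) * exp (b * t).
have rhoE t : rho t = rho' t + (rho 0 - rho' 0).
  suff : rho t - rho' t = rho 0 - rho' 0 by lra.
  apply: (is_derive_zero_constR (f := fun s => rho s - rho' s)) => s.
  apply: is_derive_eq (is_derive_minus _ _ _ _
    (- (a + 1 / 4) * (T 2%N s + b * T 1%N s)) (drho s) _) _.
    by rewrite (T12 s).1 (T12 s).2 /rho'; auto_derive=> //; field.
  by rewrite /minus /plus /opp /=; ring.
(* [c1] and [c2] are read off [T 1 = b (c1 exp (b t) - c2 exp (- b t))]; the second summand of [c6]
   compensates the term [- b (1/4 + a) c3] that [v3] brings into [phi]. *)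
exists (al / b), (- (be / b)), (T 0%N 0 - T' 0), mu, nu,
  (rho 0 - rho' 0 + b * (1 / 4 + a) * (T 0%N 0 - T' 0)).
move=> k p [x0 y0]; rewrite (point_xytE p).
set x := p (Some iX) in x0 *; set y := p (Some iY) in y0 *.
set t := p (Some iT); set u := p None.
case: k => [i|]; first case: (ord3P i) => ->.
- rewrite [LHS]xiE // A0 C0 (T12 t).1 /symmetry_field /vf3 /=; field; lra.
- rewrite [LHS]gamE // C0 (T12 t).1 (B01 t).1 /symmetry_field /vf3 /=; field; lra.
- rewrite [LHS]tauE // TE /symmetry_field /vf3 /=.
  by rewrite {1}/T'; field.
have Dp : quadrant (point_xyt x y t u) by [].
rewrite [LHS](@affine_u_at1 _ _ _ _ (fun q s Dq => quadrant_upd_u s Dq) aff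
  (point_xyt x y t u) Dp) upd_u -/phi phiE //.
rewrite rhoE (T12 t).1 (T12 t).2 (B01 t).1 (B01 t).2 /symmetry_field /vf3 /=.
by rewrite {1}/rho'; field.
Qed.

Lemma symmetry_field_inj c1 c2 c3 c4 c5 c6 :
  vf_eq quadrant (symmetry_field a b c1 c2 c3 c4 c5 c6) (@vf_zero 3) ->
  [/\ c1 = 0, c2 = 0, c3 = 0 & [/\ c4 = 0, c5 = 0 & c6 = 0]].
Proof.
move=> H.
have D t : quadrant (point_xyt 1 1 t 1) by split; rewrite /=; lra.
have TH t := H (Some iT) _ (D t); have GH t := H (Some iY) _ (D t).
have PH t := H None _ (D t).
rewrite /symmetry_field /vf3 /vf_zero /= in TH GH PH.
(* At [t = 0] and [t = ln 2 / b], [- ln 2 / b] the exponentials in [tau] take the values [1], [2],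
   [1/2], which leaves linear equations with rational coefficients; [t = 2 ln 2 / b] does the same
   for [exp (b t / 2)]. *)
have e2 : exp (ln 2) = 2 by rewrite exp_ln; lra.
have eh : exp (- ln 2) = / 2 by rewrite exp_Ropp e2.
have := TH 0; have := TH (ln 2 / b); have := TH (- ln 2 / b).
rewrite !Rmult_0_r exp_0.
have -> : b * (ln 2 / b) = ln 2 by field.
have -> : - b * (ln 2 / b) = - ln 2 by field.
have -> : b * (- ln 2 / b) = - ln 2 by field.
have -> : - b * (- ln 2 / b) = ln 2 by field.
rewrite e2 eh => T1 T2 T3.
have c10 : c1 = 0 by lra.
have c20 : c2 = 0 by lra.
have := GH 0; have := GH (2 * ln 2 / b).
have -> : b / 2 * (2 * ln 2 / b) = ln 2 by field.
have -> : - b / 2 * (2 * ln 2 / b) = - ln 2 by field.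
rewrite !Rmult_0_r exp_0 sqrt_1 e2 eh c10 c20 => G1 G2.
have c40 : c4 = 0 by lra.
have c30 : c3 = 0 by lra.
have c50 : c5 = 0 by lra.
by have := PH 0; rewrite c10 c30 c40 => P0; split=> //; split=> //; lra.
Qed.

(** [E, F, H, X, Y, Z] go to [v1], [- v2 / b^2], [(2/b) v3], [- b v4], [v5], [b^2 v6]. With [E] and
    [Y] sent to [v1] and [v5], the other scalars come from [[v1, v2] = - 2 b v3], [[v1, v5] = - b
    v4], [[v4, v5] = - b v6] and the requirement that [H] act with weight 2 on [E]. *)
Definition M_symmetry_field (c : Mgen -> R) : vfield 3 :=
  symmetry_field a b (c gE) (- c gF / b ^ 2) (2 / b * c gH) (- b * c gX) (c gY)
    (b ^ 2 * c gZ).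

Lemma M_symmetry_field_bracket c c' : vf_eq quadrant
  (M_symmetry_field (M_bracket c c'))
  (vf_bracket (M_symmetry_field c) (M_symmetry_field c')).
Proof.
move=> k p [x0 y0]; rewrite (point_xytE p).
move: (p (Some iX)) (p (Some iY)) (p (Some iT)) (p None) x0 y0 => x y t u x0 y0.
have S0 := sqrt_lt_R0 _ y0; have [r r0 yr] := pos_square y0.
(* All exponentials are powers of [w = exp (b t / 2)], and [y = r * r], so the brackets become
   rational identities in [w] and [r]. *)
have e0 := exp_pos (b / 2 * t).
have E1 : exp (b * t) = exp (b / 2 * t) * exp (b / 2 * t).
  by rewrite -exp_plus; congr exp; field.
have E2 : exp (- b / 2 * t) = / exp (b / 2 * t).
  by rewrite -exp_Ropp; congr exp; field.
have E3 : exp (- b * t) = / exp (b / 2 * t) * / exp (b / 2 * t).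
  by rewrite -exp_Ropp -exp_plus; congr exp; field.
rewrite /vf_bracket /sum_coord rsum3 /M_symmetry_field.
case: k => [i|]; first case: (ord3P i) => ->; rewrite !symmetry_field_partials //;
  rewrite /symmetry_field /vf3 /= !M_bracketE E1 E2 E3 yr sqrt_square; try lra;
  move: (exp (b / 2 * t)) e0 => w w0; by field; lra.
Qed.

End SymmetryField.

(** * The basis and the isomorphisms *)

Lemma lincomb_vbasis a b d e (c : 'I_6 -> R) : vf_eq quadrant
  (lincomb (G := L a b d e) c (vbasis a b))
  (symmetry_field a b (c (@Ordinal 6 0 isT)) (c (@Ordinal 6 1 isT))
    (c (@Ordinal 6 2 isT)) (c (@Ordinal 6 3 isT)) (c (@Ordinal 6 4 isT))
    (c (@Ordinal 6 5 isT))).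
Proof.
move=> k p _; rewrite /lincomb !big_ord_recl big_ord0.
rewrite /= /vf_add /vf_scale /vf_zero /vbasis !(tnth_nth (v6)) /=.
have I6 (i j : 'I_6) : val i = val j -> c i = c j by move=> /val_inj->.
rewrite (I6 ord0 (@Ordinal 6 0 isT)) //.
rewrite (I6 (lift ord0 ord0) (@Ordinal 6 1 isT)) //.
rewrite (I6 (lift ord0 (lift ord0 ord0)) (@Ordinal 6 2 isT)) //.
rewrite (I6 (lift ord0 (lift ord0 (lift ord0 ord0))) (@Ordinal 6 3 isT)) //.
rewrite (I6 (lift ord0 (lift ord0 (lift ord0 (lift ord0 ord0))))
  (@Ordinal 6 4 isT)) //.
rewrite (I6 (lift ord0 (lift ord0 (lift ord0 (lift ord0 (lift ord0 ord0)))))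
  (@Ordinal 6 5 isT)) //.
rewrite /v1 /v2 /v3 /v4 /v5 /v6 /symmetry_field /vf3.
by case: k => [i|]; first case: (i == iX); try case: (i == iY); field.
Qed.

End XYT.

(* The original has no hypothesis a <> 3/4, but is false for a = 3/4: there
   sqrt x exp(-b t/2) d/dx - exp(-b t/2) / (2 sqrt x) u d/du is a symmetry
   outside the span of v1, ..., v6. *)
Theorem mainTheorem14 (a b d e : R)
  (ha : a <> 1 / 4) (ha' : a <> 3 / 4) (hd : d = 1 / 4)
  (hbe : b = e) (hb : b <> 0) :
  is_lie_algebra (L a b d e) /\
  is_basis (G := L a b d e) (vbasis a b) /\
  lie_isomorphic (L a b d e) M /\
  lie_isomorphic M H00.
Proof.
subst d e.
have iso : lie_isomorphic (L a b (1 / 4) b) M.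
  apply: (@lie_isomorphic_symmetries_M _ _ _ open_quadrant (M_symmetry_field a b)).
  - by move=> c; apply: symmetry_field_mem.
  - move=> v mv.
    have [c1 [c2 [c3 [c4 [c5 [c6 vE]]]]]] := symmetry_field_onto hb ha ha' mv.
    (* The scalars of [M_symmetry_field] inverted. *)
    exists (fun g => match g with gE => c1 | gF => - b ^ 2 * c2 | gH => b / 2 * c3
                     | gX => - c4 / b | gY => c5 | gZ => c6 / b ^ 2 end).
    rewrite /M_symmetry_field.
    have -> : - (- b ^ 2 * c2) / b ^ 2 = c2 by field.
    have -> : 2 / b * (b / 2 * c3) = c3 by field.
    have -> : - b * (- c4 / b) = c4 by field.
    by have -> : b ^ 2 * (c6 / b ^ 2) = c6 by field.
  - move=> c c' k p _; rewrite /vf_add /M_symmetry_field /symmetry_field /vf3.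
    by case: k => [i|]; first case: (i == iX); try case: (i == iY); field.
  - move=> r c k p _; rewrite /vf_scale /M_symmetry_field /symmetry_field /vf3.
    by case: k => [i|]; first case: (i == iX); try case: (i == iY); field.
  - move=> c /(symmetry_field_inj hb)[E F H [X Y Z]].
    have b2 : b ^ 2 <> 0 by apply: pow_nonzero.
    have nz s z : s <> 0 -> s * z = 0 -> z = 0 by move=> s0 /Rmult_integral[].
    case=> //.
    + by apply: (nz (- / b ^ 2)); [have := Rinv_neq_0_compat _ b2; lra|lra].
    + by apply: nz H; apply: Rmult_integral_contrapositive_currified;
        [lra|exact: Rinv_neq_0_compat].
    + by apply: nz X; lra.
    + exact: nz Z.
  - exact: M_symmetry_field_bracket.
split; first by case: iso.
split; last by split=> //; apply: lie_isomorphic_M_H00.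
split.
(* Each [v_i] is the combination with Kronecker delta coefficients, so its membership follows from
   [symmetry_field_mem]. *)
- move=> i; suff [c cE] : exists c : 'I_6 -> R,
      vf_eq quadrant (lincomb (G := L a b (1 / 4) b) c (vbasis a b)) (vbasis a b i).
    apply: (is_linear_symmetry_ext open_quadrant (v := lincomb
      (G := L a b (1 / 4) b) c (vbasis a b))) => //.
    apply: (is_linear_symmetry_ext open_quadrant _
      (symmetry_field_mem a b _ _ _ _ _ _)).
    by move=> k p Dp; rewrite lincomb_vbasis.
  exists (fun j => if j == i then 1 else 0) => k p Dp.
  rewrite lincomb_vbasis // /vbasis /symmetry_field.
  case: k => [l|]; first case: (ord3P l) => ->;
    case: i => [[|[|[|[|[|[|//]]]]]] Hi]; rewrite (tnth_nth v6) /=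
      /v1 /v2 /v3 /v4 /v5 /v6 /vf3 /=; field.
- move=> c cE.
  have [] := @symmetry_field_inj a b hb (c (@Ordinal 6 0 isT)) (c (@Ordinal 6 1 isT))
    (c (@Ordinal 6 2 isT)) (c (@Ordinal 6 3 isT)) (c (@Ordinal 6 4 isT))
    (c (@Ordinal 6 5 isT)).
    by move=> k p Dp; rewrite -(lincomb_vbasis a b (1 / 4) b c k Dp) cE.
  move=> E0 E1 E2 [E3 E4 E5] i.
  by case: i => [[|[|[|[|[|[|//]]]]]] Hi];
    [rewrite -[RHS]E0|rewrite -[RHS]E1|rewrite -[RHS]E2|rewrite -[RHS]E3
    |rewrite -[RHS]E4|rewrite -[RHS]E5]; congr c; apply: val_inj.
- move=> v mv.
  have [c1 [c2 [c3 [c4 [c5 [c6 vE]]]]]] := symmetry_field_onto hb ha ha' mv.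
  exists (fun i : 'I_6 => nth 0 [:: c1; c2; c3; c4; c5; c6] i) => k p Dp.
  by rewrite vE // lincomb_vbasis.
Qed.
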